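(* Let $n\ge1$ and $\mathbf{A}=\mathbb{Z}[\frac12][v,v^{-1}]$. Every trace function $\phi:\mathcal{H}^c_{n,\mathbf{A}}\to\mathbf{A}$ is uniquely determined by its values on the elements $T_{w_\nu}$ for $\nu\in\mathcal{OP}_n$. Moreover, for $\sigma\in S_n$ and $I\subseteq\{1,\ldots,n\}$ with $|I|$ even, the elements $f_{\sigma,I;\nu}\in\mathbf{A}$ ($\nu\in\mathcal{OP}_n$) satisfying $$T_{\sigma}C_I\equiv\sum_{\nu\in\mathcal{OP}_n}f_{\sigma,I;\nu}\,T_{w_\nu}\mod [\mathcal{H}^c_{n,\mathbf{A}},\mathcal{H}^c_{n,\mathbf{A}}]_{\bar 0}$$ are uniquely determined by $\sigma$, $I$ and $\nu$.
   Context: Hecke-Clifford algebra. Let $v$ be an indeterminate. $\mathcal{H}_n^c$ is the associative superalgebra over $\mathbb{C}(v^{1/2})$ with even generators $T_1,\ldots,T_{n-1}$ and odd generators $c_1,\ldots,c_n$ and relations: $(T_i-v)(T_i+1)=0$; $T_iT_j=T_jT_i$ for $|i-j|>1$; $T_iT_{i+1}T_i=T_{i+1}T_iT_{i+1}$; $c_i^2=1$, $c_ic_j=-c_jc_i$ for $i\ne j$; $T_ic_j=c_jT_i$ for $j\neq i,i+1$; $T_ic_i=c_{i+1}T_i$. $\mathcal{H}^c_{n,\mathbf{A}}$ is the $\mathbf{A}$-subalgebra generated by all $T_i$ and $c_j$. For $\sigma\in S_n$ with reduced expression $\sigma=s_{i_1}\cdots s_{i_r}$ ($s_i=(i,i+1)$),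 $T_\sigma=T_{i_1}\cdots T_{i_r}$; for $I=\{i_1<\cdots<i_k\}\subseteq\{1,\ldots,n\}$, $C_I=c_{i_1}\cdots c_{i_k}$, $C_\emptyset=1$. The elements $T_\sigma C_I$ form an $\mathbf{A}$-basis of $\mathcal{H}^c_{n,\mathbf{A}}$. For a composition $\gamma=(\gamma_1,\ldots,\gamma_\ell)$ of $n$ (positive parts) put $T_{\gamma,j}=T_{\gamma_1+\cdots+\gamma_{j-1}+1}T_{\gamma_1+\cdots+\gamma_{j-1}+2}\cdots T_{\gamma_1+\cdots+\gamma_j-1}$ (equal to $1$ if $\gamma_j=1$) and $T_{w_\gamma}=T_{\gamma,1}\cdots T_{\gamma,\ell}$. $\mathcal{OP}_n$ is the set of partitions of $n$ with all parts odd. A trace function on an $R$-superalgebra $\mathcal{H}$ (free as $R$-module) is an $R$-linear map $\phi:\mathcal{H}\to R$ with $\phi(hh')=\phi(h'h)$ for all $h,h'$ and $\phi(h)=0$ for all odd $h$. $[\mathcal{H},\mathcal{H}]$ is the $R$-span of all ordinary commutators $hh'-h'h$ (not supercommutators), and the subscript $\bar0$ denotes the even part. *)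

(* Defs.v *)
From HB Require Import structures.
From mathcomp Require Import all_boot all_order all_algebra.
From mathcomp Require Import fingroup perm generic_quotient ring_quotient.
From mathcomp Require Import boolp reals complex.
From mathcomp.multinomials Require Import monalg.

Set Implicit Arguments.
Unset Strict Implicit.
Unset Printing Implicit Defensive.

Import GRing.Theory.

Local Open Scope ring_scope.

(* Unital associative algebras presented by generators and relations: the
   quotient of the free algebra K<X>, i.e. of the monoid algebra of the words
   over X, by the two-sided ideal generated by rel.  The quotient is only a
   pzRingType: that it is nonzero depends on rel. *)
Notation free_alg K X := {malg K[{fmonom X}]}.

Definition letter (K : comNzRingType) (X : choiceType) (x : X) :
  free_alg K X := mkmalgU (fmu x) 1.

Section Presentation.
Variables (K : comNzRingType) (X : choiceType).
Variable rel : free_alg K X -> Prop.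

Inductive ideal_gen : free_alg K X -> Prop :=
| Ideal_rel r : rel r -> ideal_gen r
| Ideal_0 : ideal_gen 0
| Ideal_sub x y : ideal_gen x -> ideal_gen y -> ideal_gen (x - y)
| Ideal_mul a x b : ideal_gen x -> ideal_gen (a * x * b).

Definition ideal_pred : {pred free_alg K X} := fun x => `[< ideal_gen x >].

Lemma ideal_zmod_closed : zmod_closed ideal_pred.
Proof.
split; first exact/asboolP/Ideal_0.
by move=> x y /asboolP hx /asboolP hy; apply/asboolP/Ideal_sub.
Qed.

HB.instance Definition _ :=
  GRing.isZmodClosed.Build (free_alg K X) ideal_pred ideal_zmod_closed.

Lemma ideal_predM a x b : x \in ideal_pred -> a * x * b \in ideal_pred.
Proof. by move=> /asboolP hx; apply/asboolP/Ideal_mul. Qed.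

Lemma ideal_predMl a x : x \in ideal_pred -> a * x \in ideal_pred.
Proof. by move=> hx; rewrite -[_ * _]mulr1 ideal_predM. Qed.

Lemma ideal_predMr x b : x \in ideal_pred -> x * b \in ideal_pred.
Proof. by move=> hx; rewrite -[x]mul1r ideal_predM. Qed.

Definition presented : Type := Quotient.quot ideal_pred.

HB.instance Definition _ := GRing.Zmodule.on presented.

Definition presented_pi (x : free_alg K X) : presented :=
  \pi_(Quotient.quot ideal_pred)%qT x.
Definition presented_repr (x : presented) : free_alg K X :=
  repr (x : Quotient.quot ideal_pred).

Local Notation pi := presented_pi.
Local Notation rep := presented_repr.

Lemma presented_reprK : cancel rep pi.
Proof. exact: reprK. Qed.

Lemma presented_eqP x y : reflect (pi x = pi y) (x - y \in ideal_pred).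
Proof. by rewrite Quotient.idealrBE; apply: eqP. Qed.

Lemma presented_pi_is_zmod_morphism : zmod_morphism pi.
Proof.
by move=> x y; rewrite /pi raddfB.
Qed.

HB.instance Definition _ :=
  GRing.isZmodMorphism.Build (free_alg K X) presented pi
    presented_pi_is_zmod_morphism.

Definition presented_one : presented := pi 1.
Definition presented_mul (x y : presented) : presented := pi (rep x * rep y).
Definition presented_scale (a : K) (x : presented) : presented :=
  pi (a *: rep x).

Lemma presented_piM_def x y : pi (x * y) = presented_mul (pi x) (pi y).
Proof.
apply/presented_eqP; set x' := rep _; set y' := rep _.
have -> : x * y - x' * y' = (x - x') * y + x' * (y - y').
  by rewrite mulrBl mulrBr addrA subrK.
apply: rpredD.
  by apply: ideal_predMr; apply/presented_eqP; rewrite presented_reprK.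
by apply: ideal_predMl; apply/presented_eqP; rewrite presented_reprK.
Qed.

Lemma presented_piZ_def a x : pi (a *: x) = presented_scale a (pi x).
Proof.
apply/presented_eqP; rewrite -scalerBr -mul_malgC ideal_predMl //.
by apply/presented_eqP; rewrite presented_reprK.
Qed.

Lemma presented_ind (P : presented -> Prop) :
  (forall x, P (pi x)) -> forall x, P x.
Proof. by move=> h x; rewrite -[x]presented_reprK. Qed.

Lemma presented_mulA : associative presented_mul.
Proof.
elim/presented_ind=> x; elim/presented_ind=> y; elim/presented_ind=> z.
by rewrite -!presented_piM_def mulrA.
Qed.

Lemma presented_mul1 : left_id presented_one presented_mul.
Proof. by elim/presented_ind=> x; rewrite -presented_piM_def mul1r. Qed.

Lemma presented_mulr1 : right_id presented_one presented_mul.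
Proof. by elim/presented_ind=> x; rewrite -presented_piM_def mulr1. Qed.

Lemma presented_mulDl : left_distributive presented_mul +%R.
Proof.
elim/presented_ind=> x; elim/presented_ind=> y; elim/presented_ind=> z.
by rewrite -raddfD -!presented_piM_def mulrDl raddfD.
Qed.

Lemma presented_mulDr : right_distributive presented_mul +%R.
Proof.
elim/presented_ind=> x; elim/presented_ind=> y; elim/presented_ind=> z.
by rewrite -raddfD -!presented_piM_def mulrDr raddfD.
Qed.

HB.instance Definition _ := GRing.Zmodule_isPzRing.Build presented
  presented_mulA presented_mul1 presented_mulr1
  presented_mulDl presented_mulDr.

Lemma presented_scaleA a b x :
  presented_scale a (presented_scale b x) = presented_scale (a * b) x.
Proof.
by elim/presented_ind: x => x; rewrite -!presented_piZ_def scalerA.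
Qed.

Lemma presented_scale1 : left_id 1 presented_scale.
Proof. by elim/presented_ind=> x; rewrite -presented_piZ_def scale1r. Qed.

Lemma presented_scaleDr : right_distributive presented_scale +%R.
Proof.
move=> a; elim/presented_ind=> x; elim/presented_ind=> y.
by rewrite -raddfD -!presented_piZ_def scalerDr raddfD.
Qed.

Lemma presented_scaleDl x : {morph presented_scale^~ x : a b / a + b}.
Proof.
move=> a b; elim/presented_ind: x => x.
by rewrite -!presented_piZ_def scalerDl raddfD.
Qed.

HB.instance Definition _ := GRing.Zmodule_isLmodule.Build K presented
  presented_scaleA presented_scale1 presented_scaleDr presented_scaleDl.

Lemma presented_pi1 : pi 1 = 1. Proof. by []. Qed.

Lemma presented_piM x y : pi (x * y) = pi x * pi y.
Proof. exact: presented_piM_def. Qed.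

Lemma presented_piZ a x : pi (a *: x) = a *: pi x.
Proof. exact: presented_piZ_def. Qed.

Lemma presented_scaleAl a (x y : presented) : a *: (x * y) = (a *: x) * y.
Proof.
elim/presented_ind: x => x; elim/presented_ind: y => y.
by rewrite -presented_piM -!presented_piZ -presented_piM scalerAl.
Qed.

Lemma malgC_comm a (x : free_alg K X) : a%:MP * x = x * a%:MP.
Proof.
rewrite !malgM_def fgmulUg fgmulgU.
by apply: eq_bigr => k _; rewrite mulrC mul1m mulm1.
Qed.

Lemma presented_scaleAr a (x y : presented) : a *: (x * y) = x * (a *: y).
Proof.
elim/presented_ind: x => x; elim/presented_ind: y => y.
rewrite -presented_piM -!presented_piZ -presented_piM -!mul_malgC.
by rewrite mulrA malgC_comm mulrA.
Qed.

(* The Z/2-grading for which the letters satisfying odd_letter are odd and the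
   others even. *)
Variable odd_letter : pred X.

Definition free_homog (d : bool) (x : free_alg K X) : Prop :=
  forall w : {fmonom X}, mcoeff w x != 0 -> odd (count odd_letter w) = d.

Definition presented_homog (d : bool) (h : presented) : Prop :=
  exists2 x, free_homog d x & h = pi x.

End Presentation.

(* With 0-based indices, T_i (i : 'I_n.-1) is attached to the positions
   pos i = i and pos1 i = i + 1 in 'I_n. *)
Section Positions.
Variable n : nat.

Definition pos (i : 'I_n.-1) : 'I_n := widen_ord (leq_pred n) i.

Lemma pos1_subproof (i : 'I_n.-1) : (i.+1 < n)%N.
Proof. by rewrite -ltn_predRL. Qed.

Definition pos1 (i : 'I_n.-1) : 'I_n := Ordinal (pos1_subproof i).

End Positions.

Section HeckeClifford.
Variables (K : fieldType) (v : K) (n : nat).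

Definition hc_gen : choiceType := ('I_n.-1 + 'I_n)%type.

Definition odd_gen : pred hc_gen := fun x => if x is inr _ then true else false.

Local Notation fT i := (letter K (inl i : hc_gen)).
Local Notation fc j := (letter K (inr j : hc_gen)).

Inductive hc_rel : free_alg K hc_gen -> Prop :=
| Rel_quadratic i : hc_rel ((fT i - v%:MP) * (fT i + 1))
| Rel_commute (i j : 'I_n.-1) : (i.+1 < j)%N || (j.+1 < i)%N ->
    hc_rel (fT i * fT j - fT j * fT i)
| Rel_braid (i j : 'I_n.-1) : j = i.+1 :> nat ->
    hc_rel (fT i * fT j * fT i - fT j * fT i * fT j)
| Rel_c_square j : hc_rel (fc j ^+ 2 - 1)
| Rel_c_anti (i j : 'I_n) : i != j -> hc_rel (fc i * fc j + fc j * fc i)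
| Rel_Tc_commute (i : 'I_n.-1) (j : 'I_n) : j != pos i -> j != pos1 i ->
    hc_rel (fT i * fc j - fc j * fT i)
| Rel_Tc i : hc_rel (fT i * fc (pos i) - fc (pos1 i) * fT i).

Definition hecke_clifford : Type := presented hc_rel.

HB.instance Definition _ := GRing.PzRing.on hecke_clifford.
HB.instance Definition _ := GRing.Lmodule.on hecke_clifford.

Definition hc_T (i : 'I_n.-1) : hecke_clifford := presented_pi hc_rel (fT i).
Definition hc_c (j : 'I_n) : hecke_clifford := presented_pi hc_rel (fc j).

Definition hc_homog (d : bool) (h : hecke_clifford) : Prop :=
  presented_homog odd_gen d h.

(* A = Z[1/2][v, v^-1], as a subring of K. *)
Inductive in_A : K -> Prop :=
| A_half : in_A 2%:R^-1
| A_v : in_A v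
| A_vV : in_A v^-1
| A_1 : in_A 1
| A_sub x y : in_A x -> in_A y -> in_A (x - y)
| A_mul x y : in_A x -> in_A y -> in_A (x * y).

Definition A_pred : {pred K} := fun x => `[< in_A x >].

Lemma A_subring_closed : subring_closed A_pred.
Proof.
split; first exact/asboolP/A_1.
- by move=> x y /asboolP hx /asboolP hy; apply/asboolP/A_sub.
- by move=> x y /asboolP hx /asboolP hy; apply/asboolP/A_mul.
Qed.

HB.instance Definition _ :=
  GRing.isSubringClosed.Build K A_pred A_subring_closed.

Record Aring : Type := MkA { A_val :> K; A_valP : A_val \in A_pred }.

HB.instance Definition _ := [isSub for A_val].
HB.instance Definition _ := [Choice of Aring by <:].
HB.instance Definition _ := [SubChoice_isSubComNzRing of Aring by <:].

Inductive in_HA : hecke_clifford -> Prop :=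
| HA_T i : in_HA (hc_T i)
| HA_c j : in_HA (hc_c j)
| HA_1 : in_HA 1
| HA_sub x y : in_HA x -> in_HA y -> in_HA (x - y)
| HA_mul x y : in_HA x -> in_HA y -> in_HA (x * y)
| HA_scale (a : Aring) x : in_HA x -> in_HA (A_val a *: x).

Definition HA_pred : {pred hecke_clifford} := fun x => `[< in_HA x >].

Lemma HA_subring_closed : subring_closed HA_pred.
Proof.
split; first exact/asboolP/HA_1.
- by move=> x y /asboolP hx /asboolP hy; apply/asboolP/HA_sub.
- by move=> x y /asboolP hx /asboolP hy; apply/asboolP/HA_mul.
Qed.

HB.instance Definition _ :=
  GRing.isSubringClosed.Build hecke_clifford HA_pred HA_subring_closed.

Record HA : Type := MkHA { HA_val :> hecke_clifford;
                           HA_valP : HA_val \in HA_pred }.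

HB.instance Definition _ := [isSub for HA_val].
HB.instance Definition _ := [Choice of HA by <:].
HB.instance Definition _ := 
  GRing.SubChoice_isSubPzRing.Build hecke_clifford HA_pred HA HA_subring_closed.

Lemma HA_scale_subproof (a : Aring) (x : HA) : A_val a *: HA_val x \in HA_pred.
Proof. by apply/asboolP/HA_scale/asboolP/HA_valP. Qed.

Definition HA_scale_def (a : Aring) (x : HA) : HA :=
  MkHA (HA_scale_subproof a x).

Lemma HA_scaleA a b x :
  HA_scale_def a (HA_scale_def b x) = HA_scale_def (a * b) x.
Proof. by apply: val_inj; rewrite /= scalerA. Qed.

Lemma HA_scale1 : left_id 1 HA_scale_def.
Proof. by move=> x; apply: val_inj; rewrite /= scale1r. Qed.

Lemma HA_scaleDr : right_distributive HA_scale_def +%R.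
Proof. by move=> a x y; apply: val_inj; rewrite /= scalerDr. Qed.

Lemma HA_scaleDl x : {morph HA_scale_def^~ x : a b / a + b}.
Proof. by move=> a b; apply: val_inj; rewrite /= scalerDl. Qed.

HB.instance Definition _ := GRing.Zmodule_isLmodule.Build Aring HA
  HA_scaleA HA_scale1 HA_scaleDr HA_scaleDl.

Lemma T_subproof i : hc_T i \in HA_pred. Proof. exact/asboolP/HA_T. Qed.
Lemma c_subproof j : hc_c j \in HA_pred. Proof. exact/asboolP/HA_c. Qed.

Definition gen_T (i : 'I_n.-1) : HA := MkHA (T_subproof i).
Definition gen_c (j : 'I_n) : HA := MkHA (c_subproof j).

Definition HA_homog (d : bool) (h : HA) : Prop := hc_homog d (HA_val h).

Definition trace_function (phi : {scalar HA}) : Prop :=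
  (forall h h', phi (h * h') = phi (h' * h)) /\
  (forall h, HA_homog true h -> phi h = 0).

(* The A-span of the ordinary (not super) commutators, and its even part. *)
Definition in_commutators (x : HA) : Prop :=
  exists s : seq (Aring * (HA * HA)),
    x = \sum_(p <- s) p.1 *: (p.2.1 * p.2.2 - p.2.2 * p.2.1).

Definition cong_even_commutators (x y : HA) : Prop :=
  in_commutators (x - y) /\ HA_homog false (x - y).

(* Products in 'S_n are left to right: (s * t) x = t (s x). *)
Definition simple_tr (i : 'I_n.-1) : 'S_n := tperm (pos i) (pos1 i).

Definition word_perm (w : seq 'I_n.-1) : 'S_n :=
  (\prod_(i <- w) simple_tr i)%g.

Definition reduced_expr (w : seq 'I_n.-1) (s : 'S_n) : Prop :=
  word_perm w = s /\
  forall w', word_perm w' = s -> (size w <= size w')%N.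

Lemma word_perm_cat w1 w2 :
  word_perm (w1 ++ w2) = (word_perm w1 * word_perm w2)%g.
Proof. by rewrite /word_perm big_cat. Qed.

Lemma tperm_word (d : nat) (a b : 'I_n) :
  b = (a + d)%N :> nat -> exists w, word_perm w = tperm a b.
Proof.
elim: d a b => [|d IH] a b hab.
  exists [::]; rewrite (_ : b = a) ?tperm1 /word_perm ?big_nil //.
  by apply: val_inj; rewrite /= hab addn0.
have hi : (a < n.-1)%N.
  by rewrite ltn_predRL (leq_trans _ (ltn_ord b)) // ltnS hab addnS ltnS leq_addr.
pose i := Ordinal hi.
have ea : pos i = a by apply: val_inj.
have [w hw] := IH (pos1 i) b (etrans hab (esym (addSnnS _ _))).
have [d0|d_gt0] := posnP d.
  exists [:: i]; rewrite /word_perm big_seq1 /simple_tr ea.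
  by congr tperm; apply: val_inj; rewrite /= hab d0 addn1.
exists (i :: w ++ [:: i]).
rewrite -cat1s !word_perm_cat hw /word_perm !big_seq1.
have -> : (simple_tr i * (tperm (pos1 i) b * simple_tr i))%g
        = (tperm (pos1 i) b ^ simple_tr i)%g.
  by rewrite conjgE tpermV.
rewrite tpermJ /simple_tr tpermR tpermD // ?ea //.
  by rewrite -val_eqE /= hab -[X in X != _]addn0 eqn_add2l.
by rewrite -val_eqE /= hab addnS eqSS -[X in X != _]addn0 eqn_add2l eq_sym -lt0n.
Qed.

Lemma tperm_expr (a b : 'I_n) : exists w, word_perm w = tperm a b.
Proof.
have [le_ab|/ltnW le_ba] := leqP a b.
  by apply: (@tperm_word (b - a)); rewrite subnKC.
by rewrite tpermC; apply: (@tperm_word (a - b)); rewrite subnKC.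
Qed.

Lemma exists_reduced_expr (s : 'S_n) : exists w, reduced_expr w s.
Proof.
have [w0 hw0] : exists w, word_perm w = s.
  case: (prod_tpermP s) => ts -> _; elim: ts => [|[a b] ts [w hw]].
    by exists [::]; rewrite /word_perm !big_nil.
  have [w' hw'] := tperm_expr a b.
  by exists (w' ++ w); rewrite word_perm_cat big_cons hw hw'.
pose P k := `[< exists2 w, word_perm w = s & size w = k >].
have exP : exists k, P k by exists (size w0); apply/asboolP; exists w0.
have [k /asboolP [w hw hk] min_k] := ex_minnP exP.
exists w; split=> // w' hw'; rewrite hk; apply: min_k.
by apply/asboolP; exists w'.
Qed.

(* A chosen reduced expression; by Matsumoto's theorem T_perm s does not depend
   on the choice. *)
Definition reduced_word (s : 'S_n) : seq 'I_n.-1 :=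
  projT1 (cid (exists_reduced_expr s)).

Definition T_perm (s : 'S_n) : HA := \prod_(i <- reduced_word s) gen_T i.

(* Here and below, products over 'I_m are taken in increasing order. *)
Definition C_set (I : {set 'I_n}) : HA := \prod_(j in I) gen_c j.

(* T_{gamma,j}, where a = gamma_1 + ... + gamma_(j-1) and k = gamma_j. *)
Definition T_block (a k : nat) : HA :=
  \prod_(i < n.-1 | (a <= i)%N && (i.+1 < a + k)%N) gen_T i.

Definition T_comp (g : seq nat) : HA :=
  \prod_(j < size g) T_block (sumn (take j g)) (nth 0%N g j).

End HeckeClifford.

Definition is_partition (n : nat) (s : seq nat) : bool :=
  [&& sorted geq s, all (ltn 0) s & sumn s == n].

Record odd_partition (n : nat) : Type := OddPartition {
  op_seq :> seq nat;
  op_seqP : is_partition n op_seq && all odd op_seq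
}.

(* Finiteness: a partition of n has at most n parts, all at most n. *)
Section OddPartitionFinite.
Variable n : nat.

HB.instance Definition _ := [isSub for @op_seq n].
HB.instance Definition _ := [Countable of odd_partition n by <:].

Definition op_code (p : odd_partition n) : n.-bseq 'I_n.+1 :=
  insub_bseq n [seq inord k | k <- op_seq p].

Definition op_decode (b : n.-bseq 'I_n.+1) : option (odd_partition n) :=
  insub [seq val k | k <- b].

Lemma op_codeK : pcancel op_code op_decode.
Proof.
case=> s /= hs; rewrite /op_decode.
have /andP [/and3P [_ s_pos /eqP s_sum] _] := hs.
have s_size : (size s <= n)%N.
  rewrite -s_sum; elim: s s_pos {hs s_sum} => //= k s IH /andP [k0 /IH].
  by rewrite -add1n => /(leq_add k0).
have s_le k : k \in s -> (k <= n)%N.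
  rewrite -s_sum; elim: s {hs s_pos s_sum s_size} => //= k' s IH.
  rewrite inE => /orP [/eqP ->|/IH h]; first exact: leq_addr.
  exact: leq_trans h (leq_addl _ _).
rewrite /op_code /insub_bseq insubdK /=; last by rewrite unfold_in size_map.
rewrite -map_comp map_id_in; last first.
  by move=> k /s_le hk; rewrite /= inordK.
by rewrite (insubT (fun s => is_partition n s && all odd s) hs).
Qed.

HB.instance Definition _ : isFinite (odd_partition n) :=
  PCanIsFinite op_codeK.

End OddPartitionFinite.

(* The field C(v^(1/2)) over the complex numbers C = R[i]; the indeterminate
   'X of the polynomial ring stands for v^(1/2). *)
Definition C_sqrt_v (R : realType) : fieldType := {fraction {poly R[i]}}.

Definition vK (R : realType) : C_sqrt_v R := tofrac ('X ^+ 2 : {poly R[i]}).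

(* Main.v *)
From HB Require Import structures.
Require Import Defs.
From mathcomp Require Import all_boot all_order all_algebra.
From mathcomp Require Import fingroup perm reals complex boolp.
From mathcomp Require Import generic_quotient ring_quotient finmap.
From mathcomp.multinomials Require Import monalg.
From mathcomp Require Import zify ring.

Set Implicit Arguments.
Unset Strict Implicit.
Unset Printing Implicit Defensive.

Import GRing.Theory.

Local Open Scope ring_scope.


(** Both halves of the theorem say that the elements T_(w_nu), for nu a
    partition into odd parts, form a basis of the even part of the algebra
    modulo commutators.

    Spanning.  Write H_k for the subalgebra on the first k positions.  As in the
    Hecke algebra, H_(k+1) = H_k + H_k c_k + H_k T_(k-1) H_k
    ([supported_coset_form]), and a factor b of H_k standing to the right of
    T_(k-1) commutes up to sign with everything further right, so it can be
    carried around to the front modulo commutators.  Iterating, every element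
    becomes a combination of products of blocks T_a T_(a+1) ... T_(a+r-2), each
    possibly preceded by c_a ([G_reduce]).  Three facts finish.
    - Two odd elements of the algebra on disjoint sets of positions
      anticommute, so x y is congruent to y x = - x y; as 2 is invertible, a
      product with a block carrying some c_a vanishes when its total degree is
      even ([G_has_decorated]).
    - For a block B of even length r with last position m = a+r-1, moving
      Clifford generators around the block gives c_a B c_m congruent to -B.  On
      the other hand B c_m is c_a B plus terms in which one T_j of the chain has
      been removed.  Hence 2 B is congruent to a combination of products of two
      shorter blocks ([even_block]), and induction on the number of blocks
      leaves odd lengths only.
    - Adjacent blocks are exchanged by conjugation with an invertible product of
      generators, so the lengths can be sorted ([G_perm]).

    Independence.  It is enough to find linear forms that vanish on commutators
    and whose values on the T_(w_nu) form an invertible matrix.  The algebra acts on functions of words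
    of length n in letters with a sign bit; this is the sum of the modules
    induced from the index representations of the parabolic Hecke subalgebras,
    the sign bits recording a monomial in the Clifford generators.  The action
    preserves the content lam of a word (how often each letter occurs), so the
    trace over the words of content lam vanishes on commutators
    ([chi_commutators]).  Its values on the T_(w_nu) are polynomials in v.  At
    v = 1 the generators only permute words, up to sign, and T_(w_nu) rotates
    each block: its trace counts the words that are constant on the blocks of nu
    and have content lam, without signs since the blocks are odd
    ([act_word_block_diag]).  If there is such a word then nu refines lam; so
    the matrix at v = 1 is triangular for the number of parts, with nonzero
    diagonal ([det_trace_mx1]), and the determinant is not zero for
    indeterminate v either. *)

(** * Relations among the generators *)
Section PresentedRelations.
Variables (K : comNzRingType) (X : choiceType) (rel : free_alg K X -> Prop).
Local Notation pi := (presented_pi rel).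

Lemma presented_rel0 r : rel r -> pi r = 0.
Proof.
move=> hr; have := raddf0 pi => /= <-.
by apply/presented_eqP; rewrite subr0; apply/asboolP/Ideal_rel.
Qed.

Lemma presented_rel2 a b c d : rel (a * b - c * d) -> pi a * pi b = pi c * pi d.
Proof.
move=> /presented_rel0 hr; rewrite -(presented_piM rel a) -(presented_piM rel c).
by apply/eqP; rewrite -subr_eq0 -raddfB; apply/eqP.
Qed.

Lemma presented_rel3 a b c d e f : rel (a * b * c - d * e * f) ->
  pi a * pi b * pi c = pi d * pi e * pi f.
Proof.
move=> /presented_rel2 hr.
by rewrite -(presented_piM rel a) -(presented_piM rel d).
Qed.

Lemma presented_rel_anti a b c d :
  rel (a * b + c * d) -> pi a * pi b = - (pi c * pi d).
Proof.
move=> /presented_rel0 hr; rewrite -(presented_piM rel a) -(presented_piM rel c).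
by apply/eqP; rewrite -addr_eq0 -raddfD; apply/eqP.
Qed.

Lemma presented_rel_sq a : rel (a ^+ 2 - 1) -> pi a * pi a = 1.
Proof.
move=> /presented_rel0 hr; rewrite -(presented_piM rel a) -presented_pi1.
by apply/eqP; rewrite -subr_eq0 -raddfB; apply/eqP.
Qed.

Lemma presented_rel_quad (q : K) a : rel ((a - q%:MP) * (a + 1)) ->
  pi a * pi a = (q - 1) *: pi a + q *: (1 : presented rel).
Proof.
move=> /presented_rel0 hr; rewrite -presented_pi1 -(presented_piM rel a).
rewrite -!presented_piZ -raddfD; apply/eqP; rewrite -subr_eq0 -raddfB.
apply/eqP; apply: etrans hr; congr presented_pi.
rewrite mulrBl !mulrDr !mulr1 scalerBl scale1r mul_malgC.
by rewrite -[q%:MP]mulr1 mul_malgC opprD opprB addrA [in RHS]opprD !addrA addrAC.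
Qed.

End PresentedRelations.

Section Relations.
Variables (K : fieldType) (v : K) (n : nat).
Local Notation H := (HA v n).
Local Notation A := (Aring v).

Lemma HA_scalerAl (a : A) (x y : H) : a *: (x * y) = (a *: x) * y.
Proof. by apply: val_inj; apply: presented_scaleAl. Qed.

Lemma HA_scalerAr (a : A) (x y : H) : a *: (x * y) = x * (a *: y).
Proof. by apply: val_inj; apply: presented_scaleAr. Qed.

Definition vA : A := MkA (asboolT (A_v v)).
Definition viA : A := MkA (asboolT (A_vV v)).
Definition halfA : A := MkA (asboolT (A_half v)).

(** Indexing the generators by all natural numbers, with value 1 beyond the
    range, leaves bounds only on the relations that need them. *)
Definition HA_T (i : nat) : H := oapp (@gen_T K v n) 1 (insub i).
Definition HA_c (j : nat) : H := oapp (@gen_c K v n) 1 (insub j).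

Lemma HA_T_ord (i : 'I_n.-1) : HA_T i = gen_T v i.
Proof. by rewrite /HA_T valK. Qed.

Lemma HA_c_ord (j : 'I_n) : HA_c j = gen_c v j.
Proof. by rewrite /HA_c valK. Qed.

Variant HA_T_spec (i : nat) : H -> Prop :=
| HTin (j : 'I_n.-1) of i = j : HA_T_spec i (gen_T v j)
| HTout of (n <= i.+1)%N : HA_T_spec i 1.

Lemma HA_TP i : HA_T_spec i (HA_T i).
Proof.
rewrite /HA_T; case: insubP => [j _ <-|] /=; first exact: HTin.
by move=> h; apply: HTout; lia.
Qed.

Variant HA_c_spec (i : nat) : H -> Prop :=
| HCin (j : 'I_n) of i = j : HA_c_spec i (gen_c v j)
| HCout of (n <= i)%N : HA_c_spec i 1.

Lemma HA_cP i : HA_c_spec i (HA_c i).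
Proof.
rewrite /HA_c; case: insubP => [j _ <-|] /=; first exact: HCin.
by move=> h; apply: HCout; lia.
Qed.

Lemma HA_T_quad i : (i.+1 < n)%N ->
  HA_T i * HA_T i = (vA - 1) *: HA_T i + vA *: (1 : H).
Proof.
case: HA_TP => [j _ _|]; last lia.
by apply: val_inj; apply: presented_rel_quad (Rel_quadratic v j).
Qed.

Lemma HA_T_comm i j : (i.+1 < j)%N -> HA_T i * HA_T j = HA_T j * HA_T i.
Proof.
case: HA_TP => [i' ->|_]; last by rewrite mul1r mulr1.
case: HA_TP => [j' ->|_]; last by rewrite mul1r mulr1.
move=> hij; apply: val_inj; apply: presented_rel2 (Rel_commute _ _).
by rewrite hij.
Qed.

Lemma HA_T_braid i : (i.+2 < n)%N ->
  HA_T i * HA_T i.+1 * HA_T i = HA_T i.+1 * HA_T i * HA_T i.+1.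
Proof.
case: HA_TP => [i' ->|]; last lia.
case: HA_TP => [j' hj|]; last lia.
by move=> _; apply: val_inj; apply: presented_rel3 (Rel_braid _ (esym hj)).
Qed.

Lemma HA_c_sq j : HA_c j * HA_c j = 1.
Proof.
case: HA_cP => [j' _|_]; last by rewrite mulr1.
by apply: val_inj; apply: presented_rel_sq (Rel_c_square _ j').
Qed.

Lemma HA_c_anti i j : (i < n)%N -> (j < n)%N -> i != j ->
  HA_c i * HA_c j = - (HA_c j * HA_c i).
Proof.
case: HA_cP => [i' ->|]; last lia.
case: HA_cP => [j' ->|]; last lia.
by move=> _ _ ne; apply: val_inj; apply: presented_rel_anti (Rel_c_anti _ ne).
Qed.

Lemma HA_Tc_far i j : j != i -> j != i.+1 -> HA_T i * HA_c j = HA_c j * HA_T i.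
Proof.
case: HA_TP => [i' ->|_]; last by rewrite mul1r mulr1.
case: HA_cP => [j' ->|_]; last by rewrite mul1r mulr1.
move=> h1 h2; apply: val_inj.
exact: presented_rel2 (@Rel_Tc_commute K v n i' j' h1 h2).
Qed.

Lemma HA_Tc i : (i.+1 < n)%N -> HA_T i * HA_c i = HA_c i.+1 * HA_T i.
Proof.
move=> hi; have hi' : (i < n.-1)%N by lia.
have [eT eC] := (HA_T_ord (Ordinal hi'), HA_c_ord (pos (Ordinal hi'))).
have eC1 := HA_c_ord (pos1 (Ordinal hi')); rewrite /= in eT eC eC1.
rewrite eT eC eC1; apply: val_inj.
exact: presented_rel2 (Rel_Tc v (Ordinal hi')).
Qed.

End Relations.

(** * Words of block shape *)

(** The index sequence of T_(w_g) for the composition g, its first block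
    starting at position a. *)
Fixpoint block_word (a : nat) (g : seq nat) : seq nat :=
  if g is r :: g' then iota a r.-1 ++ block_word (a + r) g' else [::].

Lemma size_le_sumn g : all (ltn 0) g -> (size g <= sumn g)%N.
Proof. by elim: g => //= r g IH /andP[r0 /IH]; lia. Qed.

Lemma block_word_cat a g1 g2 :
  block_word a (g1 ++ g2) = block_word a g1 ++ block_word (a + sumn g1) g2.
Proof.
elim: g1 a => [|r g1 IH] a /=; first by rewrite addn0.
by rewrite IH catA addnA.
Qed.

Lemma block_word_bounds a g : all (ltn 0) g ->
  all (fun i => (a <= i)%N && (i.+1 < a + sumn g)%N) (block_word a g).
Proof.
elim: g a => [|r g IH] a //= /andP[r0 /IH h]; rewrite all_cat; apply/andP; split.
  by apply/allP => i; rewrite mem_iota; lia.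
by apply: sub_all (h (a + r)%N) => i; lia.
Qed.

(** * The decomposition of the algebra on the first k+1 positions *)
Section Spanning.
Variables (A : comNzRingType) (H : algType A) (v : A) (n : nat).
Variables (hT hc : nat -> H).
Local Notation q := (v - 1).

Hypothesis hT_quad : forall i, (i.+1 < n)%N ->
  hT i * hT i = (v - 1) *: hT i + v *: (1 : H).
Hypothesis hT_comm : forall i j, (i.+1 < j)%N -> hT i * hT j = hT j * hT i.
Hypothesis hT_braid : forall i, (i.+2 < n)%N ->
  hT i * hT i.+1 * hT i = hT i.+1 * hT i * hT i.+1.
Hypothesis hc_sq : forall j, hc j * hc j = 1.
Hypothesis hc_anti : forall i j, (i < n)%N -> (j < n)%N -> i != j ->
  hc i * hc j = - (hc j * hc i).
Hypothesis hTc_far : forall i j, j != i -> j != i.+1 -> hT i * hc j = hc j * hT i.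
Hypothesis hTc : forall i, (i.+1 < n)%N -> hT i * hc i = hc i.+1 * hT i.
Hypothesis hT_out : forall i, (n <= i.+1)%N -> hT i = 1.
Hypothesis v_inv : exists u, u * v = 1.
Hypothesis half : exists h : A, h + h = 1.

Definition invertible (x : H) := exists2 y, x * y = 1 & y * x = 1.

Lemma invertibleM x y : invertible x -> invertible y -> invertible (x * y).
Proof.
move=> [x' h1 h2] [y' h3 h4]; exists (y' * x').
  by rewrite mulrA -[x * y * y']mulrA h3 mulr1.
by rewrite mulrA -[y' * x' * x]mulrA h2 mulr1.
Qed.

Lemma hT_invertible i : invertible (hT i).
Proof.
have [hi|hi] := ltnP i.+1 n; last first.
  by exists 1; rewrite hT_out // mulr1.
have [u uv] := v_inv; exists (u *: (hT i - (v - 1) *: (1 : H))).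
  rewrite -scalerAr mulrBr -scalerAr mulr1 hT_quad // addrAC subrr add0r.
  by rewrite scalerA uv scale1r.
rewrite -scalerAl mulrBl -scalerAl mul1r hT_quad // addrAC subrr add0r.
by rewrite scalerA uv scale1r.
Qed.

(** The one relation in which a Clifford generator does not simply move past
    T_i; it follows from T_i c_i = c_(i+1) T_i because T_i is invertible. *)
Lemma hTcS i : (i.+1 < n)%N ->
  hT i * hc i.+1 = hc i * hT i - (v - 1) *: (hc i - hc i.+1).
Proof.
move=> hi; have [y h1 h2] := hT_invertible i.
have e : hT i * hc i.+1 * hT i
       = (hc i * hT i - (v - 1) *: (hc i - hc i.+1)) * hT i.
  rewrite -mulrA -hTc // mulrA hT_quad // mulrBl -mulrA hT_quad //.
  rewrite -scalerAl mulrBl -hTc // mulrDl mulrDr -?scalerAl -?scalerAr.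
  by rewrite mulr1 mul1r scalerBr opprB [RHS]addrC addrA subrK.
by rewrite -[LHS]mulr1 -h1 mulrA e -mulrA h1 mulr1.
Qed.

(** [supported a b d x]: x is a combination of words of degree d in the
    generators that involve the positions a, ..., b-1 only.  The degree is an
    index, and not a property of x, since it need not be determined by x. *)
Inductive supported (a b : nat) : bool -> H -> Prop :=
| supported0 d : supported a b d 0
| supported1 : supported a b false 1
| supportedT i : (a <= i)%N -> (i.+1 < b)%N -> supported a b false (hT i)
| supportedC j : (a <= j)%N -> (j < b)%N -> supported a b true (hc j)
| supportedD d x y : supported a b d x -> supported a b d y -> supported a b d (x + y)
| supportedZ d (r : A) x : supported a b d x -> supported a b d (r *: x)
| supportedM d e x y : supported a b d x -> supported a b e y ->
    supported a b (d (+) e) (x * y).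

Lemma supportedM_eq a b d e f x y :
  supported a b d x -> supported a b e y -> f = d (+) e -> supported a b f (x * y).
Proof. by move=> hx hy ->; apply: supportedM. Qed.

Lemma supportedN a b d x : supported a b d x -> supported a b d (- x).
Proof. by move=> hx; rewrite -scaleN1r; apply: supportedZ. Qed.

Lemma supported_widen a b a' b' d x : (a' <= a)%N -> (b <= b')%N ->
  supported a b d x -> supported a' b' d x.
Proof.
move=> ha hb; elim=> {d x} [d||i h1 h2|j h1 h2|d x y _ hx _ hy|d r x _ hx|].
- exact: supported0.
- exact: supported1.
- by apply: supportedT; lia.
- by apply: supportedC; lia.
- exact: supportedD.
- exact: supportedZ.
by move=> d e x y _ hx _ hy; apply: supportedM.
Qed.

Lemma supported_supercomm a b a' b' d e x y : (b <= a')%N -> (b' <= n)%N ->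
  supported a b d x -> supported a' b' e y -> x * y = (-1) ^+ (d && e) *: (y * x).
Proof.
move=> hb hb' hx hy.
elim: hx => {d x} [d||i h1 h2|j h1 h2|d x x' _ ix _ ix'|d r x _ ix|].
- by rewrite mul0r mulr0 scaler0.
- by rewrite mul1r mulr1 scale1r.
- elim: hy => {e y} [e||i' h1' h2'|j' h1' h2'|e y y' _ iy _ iy'|e r y _ iy|].
  + by rewrite mul0r mulr0 scaler0.
  + by rewrite mul1r mulr1 scale1r.
  + by rewrite /= expr0 scale1r; apply: hT_comm; lia.
  + by rewrite /= expr0 scale1r; apply: hTc_far; lia.
  + by rewrite mulrDr iy iy' -scalerDr mulrDl.
  + by rewrite -scalerAr iy -scalerAl !scalerA mulrC.
  move=> e e' y y' _ iy _ iy'; rewrite /= expr0 !scale1r in iy iy' *.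
  by rewrite mulrA iy -mulrA iy' mulrA.
- elim: hy => {e y} [e||i' h1' h2'|j' h1' h2'|e y y' _ iy _ iy'|e r y _ iy|].
  + by rewrite mul0r mulr0 scaler0.
  + by rewrite mul1r mulr1 scale1r.
  + by rewrite /= expr0 scale1r [RHS]hTc_far //; lia.
  + by rewrite /= expr1 scaleN1r; apply: hc_anti; lia.
  + by rewrite mulrDr iy iy' -scalerDr mulrDl.
  + by rewrite -scalerAr iy -scalerAl !scalerA mulrC.
  move=> e e' y y' _ iy _ iy'; rewrite /= in iy iy' *.
  rewrite mulrA iy -scalerAl -[y * _ * y']mulrA iy' -scalerAr scalerA mulrA.
  by rewrite signr_addb.
- by rewrite mulrDl ix ix' -scalerDr mulrDr.
- by rewrite -scalerAl ix -scalerAr !scalerA mulrC.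
move=> d d' x x' _ ix _ ix'.
rewrite -mulrA ix' -scalerAr [x * (y * _)]mulrA ix -scalerAl scalerA mulrA.
have -> : (d (+) d') && e = (d' && e) (+) (d && e) by case: (d) (d') (e) => [] [] [].
by rewrite signr_addb.
Qed.

Lemma supported_comm a b a' b' d e x y : (b <= a')%N -> (b' <= n)%N -> ~~ (d && e) ->
  supported a b d x -> supported a' b' e y -> x * y = y * x.
Proof.
move=> h1 h2 /negbTE h3 hx hy.
by rewrite (supported_supercomm h1 h2 hx hy) h3 expr0 scale1r.
Qed.

(** The span H_k + H_k c_k + H_k T_(k-1) H_k, with degrees. *)
Inductive coset_form (k : nat) : bool -> H -> Prop :=
| coset_form0 d : coset_form k d 0
| coset_formA d x : supported 0 k d x -> coset_form k d x
| coset_formC d x : supported 0 k d x -> coset_form k (~~ d) (x * hc k)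
| coset_formT d e x y : (0 < k)%N -> supported 0 k d x -> supported 0 k e y ->
    coset_form k (d (+) e) (x * hT k.-1 * y)
| coset_formD d x y : coset_form k d x -> coset_form k d y -> coset_form k d (x + y)
| coset_formZ d (r : A) x : coset_form k d x -> coset_form k d (r *: x).

Lemma coset_form_eq k d d' x x' :
  coset_form k d x -> d' = d -> x' = x -> coset_form k d' x'.
Proof. by move=> h -> ->. Qed.

Lemma coset_formN k d x : coset_form k d x -> coset_form k d (- x).
Proof. by move=> hx; rewrite -scaleN1r; apply: coset_formZ. Qed.

Lemma supported_c k e y : (k < n)%N -> supported 0 k e y ->
  y * hc k = (-1) ^+ e *: (hc k * y).
Proof.
move=> hk hy; have hck : supported k k.+1 true (hc k) by apply: supportedC; lia.
by rewrite (supported_supercomm _ _ hy hck) ?andbT.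
Qed.

Lemma supported_c' k e y : (k < n)%N -> supported 0 k e y ->
  hc k * y = (-1) ^+ e *: (y * hc k).
Proof.
by move=> hk hy; rewrite (supported_c hk hy) scalerA -expr2 sqrr_sign scale1r.
Qed.

Lemma coset_form_mulA k d e x y : (k < n)%N -> coset_form k d x -> supported 0 k e y ->
  coset_form k (d (+) e) (x * y).
Proof.
move=> hk; elim=> {d x} [d|d x hx|d x hx|d e' x z k0 hx hz|d x x' _ ix _ ix'|].
- by move=> _; rewrite mul0r; apply: coset_form0.
- by move=> hy; apply: coset_formA; apply: supportedM.
- move=> hy; rewrite -mulrA (supported_c' hk hy) -scalerAr mulrA.
  apply: coset_formZ; rewrite addNb; apply: coset_formC; exact: supportedM.
- move=> hy; rewrite -mulrA -addbA; apply: coset_formT => //; exact: supportedM.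
- by move=> hy; rewrite mulrDl; apply: coset_formD; [apply: ix|apply: ix'].
by move=> d r x _ ix hy; rewrite -scalerAl; apply: coset_formZ; apply: ix.
Qed.

Lemma coset_form_mulC k d x :
  (k < n)%N -> coset_form k d x -> coset_form k (~~ d) (x * hc k).
Proof.
move=> hk; elim=> {d x} [d|d x hx|d x hx|d e x y k0 hx hy|d x x' _ ix _ ix'|].
- by rewrite mul0r; apply: coset_form0.
- exact: coset_formC.
- by rewrite -mulrA hc_sq mulr1 negbK; apply: coset_formA.
- rewrite -mulrA (supported_c hk hy) -scalerAr; apply: coset_formZ.
  case: k hk k0 hx hy => // k hk _ hx hy; rewrite /= mulrA -[x * _ * _]mulrA.
  rewrite hTcS // mulrBr mulrBl.
  have hck : supported 0 k.+1 true (hc k) by apply: supportedC; lia.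
  apply: coset_formD; last (apply: coset_formN; rewrite -scalerAr -scalerAl).
    rewrite mulrA -[~~ _]addTb addbA; apply: coset_formT => //.
    by rewrite addbC; apply: supportedM.
  apply: coset_formZ; rewrite mulrBr mulrBl.
  apply: coset_formD; first apply: coset_formA.
    by apply: (supportedM_eq (supportedM hx hck) hy); case: (d) (e) => [] [].
  apply: coset_formN; rewrite -mulrA (supported_c' hk hy) -scalerAr mulrA.
  by apply: coset_formZ; apply: coset_formC; apply: supportedM.
- by rewrite mulrDl; apply: coset_formD.
by move=> d r x _ ix; rewrite -scalerAl; apply: coset_formZ.
Qed.

(** The crucial case of closure under multiplication by T_k: with y in H_(k+1)
    written in the same form one level down, T_k y T_k reduces by the quadratic
    relation, by T_k c_k = c_(k+1) T_k, or by the braid relation. *)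
Lemma coset_form_TyT k e y d x :
  (k.+1 < n)%N -> coset_form k e y -> supported 0 k.+1 d x ->
  coset_form k.+1 (d (+) e) (x * hT k * (y * hT k)).
Proof.
move=> hk hy.
have decT1 d1 x1 : supported 0 k.+1 d1 x1 -> coset_form k.+1 d1 (x1 * hT k).
  move=> h; apply: coset_form_eq (coset_formT (ltn0Sn k) h (supported1 _ _)) _ _.
    by rewrite addbF.
  by rewrite mulr1.
have sq : hT k * hT k = q *: hT k + v *: (1 : H) by apply: hT_quad.
have wid d1 x1 : supported 0 k d1 x1 -> supported 0 k.+1 d1 x1.
  by apply: supported_widen; lia.
have comT d1 x1 : supported 0 k d1 x1 -> hT k * x1 = x1 * hT k.
  move=> h; have hTk : supported k k.+2 false (hT k) by apply: supportedT; lia.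
  by rewrite (supported_comm _ _ _ h hTk) // ?andbF //; lia.
rewrite -mulrA; elim: hy d x => {e y}
  [e|e y hy|e y hy|e e' y z k0 hy hz|e y y' _ iy _ iy'|e r y _ iy] d x hx.
- by rewrite mul0r !mulr0; apply: coset_form0.
- have -> : hT k * (y * hT k) = q *: (y * hT k) + v *: y.
    rewrite mulrA (comT _ _ hy) -mulrA sq mulrDr -!scalerAr.
    by rewrite mulr1.
  rewrite mulrDr -!scalerAr mulrA.
  apply: coset_formD; apply: coset_formZ; [apply: decT1|apply: coset_formA];
  by apply: supportedM => //; apply: wid.
- have -> : hT k * (y * hc k * hT k) = q *: (y * hT k * hc k) + v *: (y * hc k.+1).
    rewrite !mulrA (comT _ _ hy) -!mulrA [hT k * (hc k * _)]mulrA hTc // -mulrA sq.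
    rewrite mulrDr -!scalerAr mulr1 -hTc // mulrDr -!scalerAr.
    by rewrite mulrA.
  have hck : supported 0 k.+1 true (hc k) by apply: supportedC; lia.
  rewrite mulrDr -!scalerAr !mulrA -[~~ _]addTb; apply: coset_formD; apply: coset_formZ.
    apply: coset_form_eq (coset_formT _ (supportedM hx (wid _ _ hy)) hck) _ _ => //.
    by rewrite -addbA [true (+) _]addbC.
  apply: coset_form_eq (coset_formC (supportedM hx (wid _ _ hy))) _ _ => //.
  by rewrite addTb addbN.
- case: k k0 hy hz {decT1} hk sq wid comT hx => // k _ hy hz hk sq wid comT hx /=.
  have -> : hT k.+1 * (y * hT k * z * hT k.+1)
          = (y * hT k) * hT k.+1 * (hT k * z).
    rewrite -!mulrA -(comT _ _ hz) [hT k.+1 * (y * _)]mulrA (comT _ _ hy) -!mulrA.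
    by congr (y * _); rewrite !mulrA hT_braid.
  rewrite !mulrA -[_ * hT k * z]mulrA.
  have hTk : supported 0 k.+2 false (hT k) by apply: supportedT; lia.
  have hl := supportedM (supportedM hx (wid _ _ hy)) hTk.
  apply: coset_form_eq (coset_formT _ hl (supportedM hTk (wid _ _ hz))) _ _ => //.
  by rewrite addbF addFb addbA.
- by rewrite mulrDl !mulrDr; apply: coset_formD; [apply: iy|apply: iy'].
by rewrite -scalerAl -!scalerAr; apply: coset_formZ; apply: iy.
Qed.

Lemma coset_form_mulT k d x : (k.+1 < n)%N ->
  (forall e y, supported 0 k.+1 e y -> coset_form k e y) ->
  coset_form k.+1 d x -> coset_form k.+1 d (x * hT k).
Proof.
move=> hk IH; elim=> {d x} [d|d x hx|d x hx|d e x y _ hx hy|d x x' _ ix _ ix'|].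
- by rewrite mul0r; apply: coset_form0.
- apply: coset_form_eq (coset_formT (ltn0Sn k) hx (supported1 _ _)) _ _; first by rewrite addbF.
  by rewrite mulr1.
- have hck : supported 0 k.+1 true (hc k) by apply: supportedC; lia.
  apply: coset_form_eq (coset_formT (ltn0Sn k) hx hck) _ _; first by rewrite addbT.
  by rewrite -!mulrA hTc.
- by rewrite -mulrA; apply: coset_form_TyT => //; apply: IH.
- by rewrite mulrDl; apply: coset_formD.
by move=> d r x _ ix; rewrite -scalerAl; apply: coset_formZ.
Qed.

Lemma coset_form_mul k : (k < n)%N ->
  (forall d z, (0 < k)%N -> coset_form k d z -> coset_form k d (z * hT k.-1)) ->
  forall d e z y, supported 0 k.+1 e y -> coset_form k d z ->
    coset_form k (d (+) e) (z * y).
Proof.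
move=> hk hmulT d e z y hy; elim: hy d z => {e y}
    [e||i h1 h2|j h1 h2|e y y' _ iy _ iy'|e r y _ iy|e e' y y' _ iy _ iy'] d z hz.
- by rewrite mulr0; apply: coset_form0.
- by rewrite ?addbF ?mulr1.
- have [hi|hi] := ltnP i.+1 k.
    by apply: coset_form_mulA => //; apply: supportedT.
  rewrite addbF; have ->: i = k.-1 by lia.
  by apply: hmulT => //; lia.
- have [hj|hj] := ltnP j k.
    by apply: coset_form_mulA => //; apply: supportedC.
  by rewrite addbT; have ->: j = k by [lia]; apply: coset_form_mulC.
- by rewrite mulrDr; apply: coset_formD; [apply: iy|apply: iy'].
- by rewrite -scalerAr; apply: coset_formZ; apply: iy.
by rewrite addbA mulrA; apply: iy'; apply: iy.
Qed.

(** The right-hand side contains 1 and is stable under right multiplication by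
    the generators of H_(k+1). *)
Lemma supported_coset_form k d x : (k < n)%N -> supported 0 k.+1 d x -> coset_form k d x.
Proof.
elim: k d x => [|k IH] d x hk hx; rewrite -[x]mul1r -[d]addFb.
  by apply: coset_form_mul => //; apply/coset_formA/supported1.
apply: coset_form_mul => //; last exact/coset_formA/supported1.
by move=> e y _ hy; apply: coset_form_mulT => // e' y'; apply: IH; lia.
Qed.

(** * Tracial submodules and blocks of even length *)
Definition T_word (w : seq nat) : H := \prod_(i <- w) hT i.

Lemma T_word0 : T_word [::] = 1. Proof. exact: big_nil. Qed.
Lemma T_word1 i : T_word [:: i] = hT i. Proof. exact: big_seq1. Qed.
Lemma T_word_cons i w : T_word (i :: w) = hT i * T_word w. Proof. exact: big_cons. Qed.
Lemma T_word_cat w1 w2 : T_word (w1 ++ w2) = T_word w1 * T_word w2.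
Proof. exact: big_cat. Qed.

Lemma supported_T_word a b w :
  all (fun i => (a <= i)%N && (i.+1 < b)%N) w -> supported a b false (T_word w).
Proof.
elim: w => [|i w IH] /=; first by rewrite T_word0 => _; apply: supported1.
move=> /andP[/andP[h1 h2] /IH hw]; rewrite T_word_cons -[false]addbF.
by apply: supportedM => //; apply: supportedT.
Qed.

Lemma supported_iota a b k r : (a <= k)%N -> (k + r < b)%N ->
  supported a b false (T_word (iota k r)).
Proof. by move=> h1 h2; apply/supported_T_word/allP => i; rewrite mem_iota; lia. Qed.

(** The property of being spanned by given elements modulo commutators is of this
    kind; the bounds a and b allow arguments inside one block, the rest of the
    product being absorbed into G. *)
Record tracial (a b : nat) (G : H -> Prop) : Prop := Tracial {
  trD : forall x y, G x -> G y -> G (x + y);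
  trZ : forall (r : A) x, G x -> G (r *: x);
  trC : forall d e x y, supported a b d x -> supported a b e y -> G (x * y - y * x) }.

Section Tracial.
Variables (a b : nat) (G : H -> Prop).
Hypothesis trG : tracial a b G.

Lemma tr0 : G 0.
Proof. by have := trC trG (supported1 a b) (supported1 a b); rewrite subrr. Qed.

Lemma trN x : G x -> G (- x).
Proof. by move=> gx; rewrite -scaleN1r; apply: trZ trG _ _ gx. Qed.

Lemma trB x y : G x -> G y -> G (x - y).
Proof. by move=> gx gy; apply: (trD trG) => //; apply: trN. Qed.

Lemma tr_eq x y : G (x - y) -> G y -> G x.
Proof. by move=> h gy; rewrite -[x](subrK y); apply: (trD trG). Qed.

Lemma tr_swap d e x y : supported a b d x -> supported a b e y -> G (y * x) -> G (x * y).
Proof. by move=> hx hy; apply: tr_eq; apply: trC trG _ _ _ _ hx hy. Qed.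

Lemma tr_half x : G (x + x) -> G x.
Proof.
have [h hh] := half; move=> /(trZ trG h).
by rewrite scalerDr -scalerDl hh scale1r.
Qed.

Lemma tr_sum (I : Type) (s : seq I) (P : pred I) (F : I -> H) :
  (forall i, P i -> G (F i)) -> G (\sum_(i <- s | P i) F i).
Proof. by move=> h; elim/big_ind: _ => //; [exact: tr0|exact: trD trG]. Qed.

(** x y is congruent to y x, which equals - x y. *)
Lemma tr_odd m x y : (a <= m)%N -> (m <= b)%N -> (b <= n)%N ->
  supported a m true x -> supported m b true y -> G (x * y).
Proof.
move=> h1 h2 h3 hx hy; apply: tr_half.
have e := supported_supercomm (leqnn m) h3 hx hy.
rewrite {2}e expr1 scaleN1r; apply: (trC trG).
  by apply: supported_widen hx; lia.
by apply: supported_widen hy; lia.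
Qed.

End Tracial.

(** A chain T_k ... T_(k+r-1) moves every Clifford generator one place up, except
    the last one, which is treated in the next lemma. *)
Lemma chain_c k r j : (k <= j)%N -> (j < k + r)%N -> (k + r < n)%N ->
  T_word (iota k r) * hc j = hc j.+1 * T_word (iota k r).
Proof.
elim: r k => [|r IH] k hkj hjr hn; first lia.
rewrite /= T_word_cons; have [hj|hj] := ltnP k j.
  by rewrite -mulrA IH ?mulrA; [rewrite hTc_far // |..]; lia.
have ->: j = k by lia.
rewrite -mulrA.
have hck : supported k k.+1 true (hc k) by apply: supportedC; lia.
have hw : supported k.+1 n false (T_word (iota k.+1 r)) by apply: supported_iota; lia.
by rewrite -(supported_comm _ _ _ hck hw) // ?mulrA ?hTc //; lia.
Qed.

(** Moving c_(k+r) through the chain leaves, for each s, a term of [hTcS] with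
    T_(k+s) replaced by a multiple of c_(k+s) - c_(k+s+1). *)
Lemma chain_c_last k r : (k + r < n)%N ->
  T_word (iota k r) * hc (k + r) = hc k * T_word (iota k r)
    - q *: \sum_(0 <= s < r)
        T_word (iota k s) * (hc (k + s) - hc (k + s).+1)
          * T_word (iota (k + s).+1 (r - s.+1)).
Proof.
elim: r k => [|r IH] k hn.
  by rewrite big_geq // scaler0 subr0 addn0 T_word0 mul1r mulr1.
rewrite /= T_word_cons -mulrA -addSnnS IH; last lia.
rewrite mulrBr [hT k * (hc _ * _)]mulrA hTcS; [|lia].
rewrite mulrBl -addrA -opprD -scalerAl -scalerAr -scalerDr.
rewrite -[hc k * _ * _]mulrA; congr (_ - _ *: _).
rewrite big_nat_recl // addn0 T_word0 mul1r subSS subn0; congr (_ + _).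
rewrite mulr_sumr; apply: eq_bigr => s _.
by rewrite /= T_word_cons addSnnS !mulrA subSS.
Qed.

(* In this section B is the chain on the positions a, ..., m = a+r-1. *)
Section EvenBlock.
Variables (a r : nat) (G : H -> Prop).
Hypotheses (r_gt1 : (1 < r)%N) (hn : (a + r <= n)%N).
Hypothesis trG : tracial a (a + r) G.
Local Notation B := (T_word (iota a r.-1)).
Local Notation m := (a + r).-1.

Let hBlock : supported a (a + r) false B. Proof. by apply: supported_iota; lia. Qed.
Let hcB j : (a <= j)%N -> (j < a + r)%N -> supported a (a + r) true (hc j).
Proof. exact: supportedC. Qed.

Let hBc : supported a (a + r) true (B * hc m).
Proof. by apply: (supportedM hBlock (hcB _ _)); lia. Qed.

(** Let j = m-d-1.  Since B c_j = c_(j+1) B, the element B c_j c_m is congruent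
    to B c_m c_(j+1) = - B c_(j+1) c_m; for j = m-1 it is congruent to
    B c_m c_m = B. *)
Lemma block_c_slide d : (d < r.-1)%N ->
  G (B * hc (m - d.+1) * hc m - (-1) ^+ d *: B).
Proof.
elim: d => [|d IH] hd.
  rewrite expr0 scale1r chain_c; try lia.
  have ->: (m - 1).+1 = m by lia.
  rewrite -[X in _ - X]mulr1 -(hc_sq m) mulrA -mulrA.
  apply: (trC trG (d := true) (e := true)).
    by apply: hcB; lia.
  exact: hBc.
rewrite chain_c; try lia.
have ->: (m - d.+2).+1 = (m - d.+1)%N by lia.
rewrite exprS mulN1r scaleNr opprK.
have h : G (hc (m - d.+1) * (B * hc m) - B * hc m * hc (m - d.+1)).
  apply: (trC trG (d := true) (e := true)).
    by apply: hcB; lia.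
  exact: hBc.
have := trB trG h (IH _); rewrite -[B * hc m * _]mulrA hc_anti; try lia.
rewrite mulrN opprK !mulrA => h'.
have {h'} := h' ltac:(lia).
by rewrite opprB addrA addrAC addrK.
Qed.

Hypothesis r_even : ~~ odd r.

Lemma even_block_conj : G (hc a * B * hc m + B).
Proof.
have h1 : G (hc a * (B * hc m) - B * hc m * hc a).
  by apply: (trC trG (d := true) (e := true)) => //; apply: hcB; lia.
have := @block_c_slide r.-2; have ->: (m - r.-2.+1)%N = a by lia.
have -> : (-1 : A) ^+ r.-2 = 1.
  by rewrite -signr_odd; have ->: odd r.-2 = false by lia.
rewrite scale1r => /(_ ltac:(lia)) h2.
have := trB trG h1 h2; rewrite -[B * hc m * _]mulrA hc_anti; try lia.
by rewrite mulrN opprK !mulrA opprB addrA addrAC addrK.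
Qed.

(** With T_(a+s) removed, the two Clifford generators left at the ends of the
    first part cancel: the second one slides down the chain U, with a sign at
    each step, until it meets c_a. *)
Lemma split_block_slide s : (s < r.-1)%N ->
  let U := T_word (iota a s) in let V := T_word (iota (a + s).+1 (r.-1 - s.+1)) in
  G (U * V) -> G (hc a * U * hc (a + s) * V).
Proof.
move=> hs U V hUV.
have hU : supported a (a + s).+1 false U by apply: supported_iota; lia.
have hV : supported (a + s).+1 (a + r) false V by apply: supported_iota; lia.
have cV j : (a <= j)%N -> (j <= a + s)%N -> hc j * V = V * hc j.
  move=> h1 h2; apply: (@supported_comm a (a + s).+1 (a + s).+1 (a + r) true false) => //.
  by apply: supportedC; lia.
have hcUV : supported a (a + r) true (hc a * (U * V)).
  have hUV' : supported a (a + r) false (U * V).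
    apply: (@supportedM _ _ false false).
      by apply: supported_widen hU; lia.
    by apply: supported_widen hV; lia.
  by apply: (@supportedM _ _ true false) => //; apply: hcB; lia.
have -> : hc a * U * hc (a + s) * V = hc a * (U * V) * hc (a + s).
  by rewrite -!mulrA cV ?leq_addr.
suff slide i : (i <= s)%N -> G (hc a * (U * V) * hc (a + i)).
  exact: slide.
elim: i => [|i IH] hi.
  rewrite addn0; apply: (tr_swap trG hcUV (e := true)); first by apply: hcB; lia.
  by rewrite mulrA hc_sq mul1r.
apply: (tr_swap trG hcUV (e := true)); first by apply: hcB; lia.
have -> : hc (a + i.+1) * (hc a * (U * V)) = - (hc a * (U * V) * hc (a + i)).
  rewrite -!mulrA -cV ?leq_addr //; last lia.
  rewrite [U * (_ * V)]mulrA chain_c; try lia.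
  by rewrite -addnS mulrA hc_anti ?mulNr ?mulrA //; lia.
by apply/(trN trG)/IH; lia.
Qed.

(** Comparing the two expressions for c_a B c_m gives 2 B as a combination of
    split blocks; those with c_a in the first part and c_(a+s+1) in the second
    are products of two odd elements. *)
Lemma even_block :
  (forall s, (s < r.-1)%N ->
     G (T_word (iota a s) * T_word (iota (a + s).+1 (r.-1 - s.+1)))) ->
  G B.
Proof.
move=> hs; apply: (tr_half trG).
have := even_block_conj; have ->: m = (a + r.-1)%N by lia.
rewrite -mulrA chain_c_last; last lia.
rewrite mulrBr mulrA hc_sq mul1r -scalerAr addrAC; set S := (X in _ - X) => h.
rewrite -[B + B](subrK S); apply: (trD trG) => //.
apply: (trZ trG); rewrite mulr_sumr big_nat_cond; apply: (tr_sum trG) => s.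
case/andP=> /andP[_ hsr] _.
rewrite mulrBr mulrBl mulrBr; apply: (trB trG).
  by rewrite !mulrA; apply: split_block_slide => //; apply: hs.
rewrite -[_ * _ * T_word _]mulrA [hc a * _]mulrA.
apply: (tr_odd trG (m := (a + s).+1)) => //; try lia.
  by apply: (@supportedM _ _ true false); [apply: supportedC|apply: supported_iota]; lia.
by apply: (@supportedM _ _ true false); [apply: supportedC|apply: supported_iota]; lia.
Qed.

End EvenBlock.

(** * Exchanging adjacent blocks *)
Lemma chain_T k p j : (k <= j)%N -> (j.+1 < k + p)%N -> (k + p < n)%N ->
  T_word (iota k p) * hT j = hT j.+1 * T_word (iota k p).
Proof.
elim: p k => [|p IH] k h1 h2 h3; first lia.
rewrite /= T_word_cons; have [hj|hj] := ltnP k j.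
  rewrite -mulrA IH; [|lia..].
  by rewrite !mulrA hT_comm //; lia.
have ->: j = k by lia.
case: p {IH} h2 h3 => [|p] h2 h3; first lia.
rewrite /= T_word_cons -!mulrA.
have hTk : supported k k.+2 false (hT k) by apply: supportedT; lia.
have hw : supported k.+2 n false (T_word (iota k.+2 p)) by apply: supported_iota; lia.
rewrite -(supported_comm _ _ _ hTk hw) // !mulrA hT_braid //; lia.
Qed.

(** The T_sigma of the permutation exchanging the positions a, ..., a+p-1 with
    the next q ones, as a product of q chains of length p. *)
Fixpoint cross (a p q : nat) : H :=
  if q is q'.+1 then T_word (iota (a + q') p) * cross a p q' else 1.

Lemma cross_T a p q j : (a + p + q <= n)%N -> (a <= j)%N -> (j.+1 < a + p)%N ->
  cross a p q * hT j = hT (j + q) * cross a p q.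
Proof.
move=> hn h1 h2; elim: q hn => [|q IH] hn /=; first by rewrite mul1r mulr1 addn0.
rewrite -mulrA IH; last lia.
rewrite mulrA chain_T; [by rewrite addnS mulrA|lia..].
Qed.

Lemma T_wordC j k p : (j.+1 < k)%N -> (k + p < n)%N ->
  hT j * T_word (iota k p) = T_word (iota k p) * hT j.
Proof.
move=> h1 h2; have h : supported j j.+2 false (hT j) by apply: supportedT; lia.
have h' : supported k n false (T_word (iota k p)) by apply: supported_iota; lia.
by apply: (supported_comm _ _ _ h h'); lia.
Qed.

(** The braid relation for a strand crossing two chains; it is what makes [cross]
    move the second block down. *)
Lemma chain_chain k p : (k.+1 + p < n)%N ->
  T_word (iota k.+1 p) * T_word (iota k p) * hT (k + p)
  = hT k * (T_word (iota k.+1 p) * T_word (iota k p)).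
Proof.
move=> hn.
have e : T_word (iota k p) * hT (k + p) = hT k * T_word (iota k.+1 p).
  by rewrite -T_word1 -T_word_cat -T_word_cons -[k :: _]/(iota k p.+1) -[p.+1]addn1 iotaD.
rewrite -mulrA e.
suff shift s : (s <= p)%N ->
    T_word (iota k.+1 s) * (hT k * T_word (iota k.+1 p))
  = (hT k * T_word (iota k.+1 p)) * T_word (iota k s).
  by rewrite shift; [exact: esym (mulrA _ _ _)|lia].
elim: s => [|s IH] hs; first by rewrite T_word0 mul1r mulr1.
have iS k0 : iota k0 s.+1 = iota k0 s ++ [:: (k0 + s)%N] by rewrite -addn1 iotaD.
rewrite !iS !T_word_cat !T_word1.
rewrite -[T_word (iota k.+1 s) * _ * _]mulrA.
have -> : hT (k.+1 + s) * (hT k * T_word (iota k.+1 p))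
        = (hT k * T_word (iota k.+1 p)) * hT (k + s).
  by rewrite -T_word_cons -[k :: _]/(iota k p.+1) addSn chain_T //; lia.
by rewrite mulrA IH; [rewrite mulrA|lia].
Qed.

Lemma cross_T' a p q j : (a + p + q <= n)%N -> (j.+1 < q)%N ->
  cross a p q * hT (a + p + j) = hT (a + j) * cross a p q.
Proof.
elim: q => [|q IH] hn hj //=; have [hjq|hjq] := ltnP j.+1 q.
  rewrite -mulrA IH; try lia.
  by rewrite mulrA -T_wordC ?mulrA //; lia.
have -> : q = j.+1 by lia.
rewrite /=; have hX s : (s <= j)%N ->
    cross a p s * hT (a + p + j) = hT (a + p + j) * cross a p s.
  elim: s => [|s IHs] hs /=; first by rewrite mul1r mulr1.
  rewrite -mulrA IHs; last lia.
  have h : supported (a + p + j) (a + p + j).+2 false (hT (a + p + j)).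
    by apply: supportedT; lia.
  have h' : supported (a + s) (a + p + j) false (T_word (iota (a + s) p)).
    by apply: supported_iota; lia.
  by rewrite mulrA (supported_comm _ _ _ h' h) ?mulrA //; lia.
rewrite -!mulrA hX // mulrA addnS.
rewrite (_ : a + p + j = a + j + p)%N; last lia.
by rewrite mulrA chain_chain ?addSn ?mulrA //; lia.
Qed.

Lemma cross_supported a p q b :
  (a + p + q <= b)%N -> (b <= n)%N -> supported a b false (cross a p q).
Proof.
move=> h hb; elim: q h => [|q IH] h /=; first exact: supported1.
apply: (@supportedM _ _ false false); first by apply: supported_iota; lia.
by apply: IH; lia.
Qed.

Lemma cross_invertible a p q : invertible (cross a p q).
Proof.
have inv1 : invertible (1 : H) by exists 1; rewrite mulr1.
elim: q => [|q IH] //=; apply: invertibleM => //.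
elim: p (a + q)%N {IH} => [|p IH] k; first by rewrite T_word0.
by rewrite /= T_word_cons; apply: invertibleM => //; apply: hT_invertible.
Qed.

Lemma cross_blocks a p q : (0 < p)%N -> (0 < q)%N -> (a + p + q <= n)%N ->
  cross a p q * (T_word (iota a p.-1) * T_word (iota (a + p) q.-1))
  = T_word (iota a q.-1) * T_word (iota (a + q) p.-1) * cross a p q.
Proof.
move=> p0 q0 hn.
have shiftp s k : (a <= k)%N -> (k + s < a + p)%N ->
    cross a p q * T_word (iota k s) = T_word (iota (k + q) s) * cross a p q.
  elim: s k => [|s IH] k h1 h2; first by rewrite T_word0 mul1r mulr1.
  rewrite /= !T_word_cons mulrA cross_T // -?mulrA; try lia.
  by rewrite IH ?addSn //; lia.
have shiftq s k : (k + s < q)%N ->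
    cross a p q * T_word (iota (a + p + k) s) = T_word (iota (a + k) s) * cross a p q.
  elim: s k => [|s IH] k h1; first by rewrite T_word0 mul1r mulr1.
  rewrite /= !T_word_cons mulrA cross_T' // -?mulrA; try lia.
  by rewrite -!addnS IH //; lia.
rewrite mulrA shiftp //; try lia.
rewrite -mulrA -[(a + p)%N]addn0 shiftq; last lia.
rewrite addn0 mulrA; congr (_ * _).
have h : supported a (a + q) false (T_word (iota a q.-1)) by apply: supported_iota; lia.
have h' : supported (a + q) n false (T_word (iota (a + q) p.-1)).
  by apply: supported_iota; lia.
by rewrite (supported_comm _ _ _ h h').
Qed.

(** * Reduction to odd partitions *)
Section Reduction.
Variable G : H -> Prop.
Hypothesis GD : forall x y, G x -> G y -> G (x + y).
Hypothesis GZ : forall (r : A) x, G x -> G (r *: x).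
Hypothesis GC : forall x y, G (x * y - y * x).
Hypothesis Godd : forall s, is_partition n s -> all odd s -> G (T_word (block_word 0 s)).

Let trG : tracial 0 n G. Proof. by split=> // *; apply: GC. Qed.

Lemma G_conj x y z : x * y = 1 -> y * x = 1 -> G z -> G (x * z * y).
Proof.
move=> xy yx gz; apply: (tr_eq trG (GC _ _)).
by rewrite mulrA yx mul1r.
Qed.

(** [cross] commutes with the remaining blocks, so conjugating by it exchanges
    the two blocks and changes nothing else. *)
Lemma G_swap_blocks s1 p q s2 : all (ltn 0) (s1 ++ p :: q :: s2) ->
  sumn (s1 ++ p :: q :: s2) = n ->
  G (T_word (block_word 0 (s1 ++ p :: q :: s2))) ->
  G (T_word (block_word 0 (s1 ++ q :: p :: s2))).
Proof.
rewrite all_cat sumn_cat /= => /andP[s1p /and3P[p0 q0 s2p]] hn.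
rewrite !block_word_cat add0n /= !T_word_cat.
set a := sumn s1; set L := T_word (block_word 0 s1).
rewrite (_ : a + q + p = a + p + q)%N; last lia.
set R := T_word (block_word (a + p + q) s2) => g.
have [Y XY YX] := cross_invertible a p q.
have hX : supported a (a + p + q) false (cross a p q) by apply: cross_supported; lia.
have hL : supported 0 a false L by apply/supported_T_word; have := block_word_bounds 0 s1p.
have hR : supported (a + p + q) n false R.
  apply/supported_T_word; have := block_word_bounds (a + p + q) s2p.
  by rewrite (_ : _ + sumn s2 = n)%N //; lia.
have LX : L * cross a p q = cross a p q * L.
  by apply: (supported_comm _ _ _ hL hX) => //; lia.
have XR : cross a p q * R = R * cross a p q.
  by apply: (supported_comm _ _ _ hX hR) => //; lia.
have YR : Y * R = R * Y.
  by rewrite -[Y * R]mulr1 -XY mulrA -[Y * R * _]mulrA -XR mulrA YX mul1r.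
have BB : T_word (iota a q.-1) * T_word (iota (a + q) p.-1)
   = cross a p q * (T_word (iota a p.-1) * T_word (iota (a + p) q.-1)) * Y.
  rewrite cross_blocks //; last lia.
  by rewrite -[RHS]mulrA XY mulr1.
have := G_conj XY YX g; congr G.
rewrite [T_word (iota a q.-1) * (_ * _)]mulrA BB -!mulrA YR.
by rewrite [L * (cross _ _ _ * _)]mulrA LX -!mulrA.
Qed.

Definition composition (s : seq nat) := all (ltn 0) s && (sumn s == n).

Lemma composition_perm s t : perm_eq s t -> composition s = composition t.
Proof.
by move=> st; rewrite /composition (perm_all _ st) (perm_sumn st).
Qed.

(** The common prefix pre makes the induction on t go through: the head of t is
    moved to the front of s by adjacent exchanges and then joins pre. *)
Lemma G_perm s t pre : perm_eq s t -> composition (pre ++ s) ->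
  G (T_word (block_word 0 (pre ++ s))) -> G (T_word (block_word 0 (pre ++ t))).
Proof.
elim: t s pre => [|x t IH] s pre st; first by move/perm_nilP: st => ->.
have xs : x \in s by rewrite (perm_mem st) mem_head.
case/splitPr: xs st => s1 s2 st; rewrite -cat1s catA.
have {}st : perm_eq (s1 ++ s2) t.
  by rewrite -(perm_cons x) -cat1s perm_catCA.
move=> hc0 g0; rewrite -cat_rcons -cats1.
have : composition ((pre ++ [:: x]) ++ (s1 ++ s2)) /\
       G (T_word (block_word 0 ((pre ++ [:: x]) ++ (s1 ++ s2)))).
  elim/last_ind: s1 s2 {st} hc0 g0 => [|s1 y IHs] s2; first by rewrite -!catA.
  rewrite -!catA !cat_rcons => h1 g1.
  have h2 : composition (pre ++ s1 ++ x :: y :: s2).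
    rewrite (composition_perm (t := pre ++ s1 ++ y :: x :: s2)) //.
    by rewrite !perm_cat2l -[x :: _]/([:: x] ++ [:: y] ++ s2) perm_catCA.
  have := IHs (y :: s2); rewrite -!catA; apply=> //=.
  case/andP: h1 => h1 /eqP h1'; rewrite catA in g1 h1 h1'; rewrite catA.
  exact: G_swap_blocks g1.
by case=> h1 g1; apply: IH g1.
Qed.

Lemma G_odd s : composition s -> all odd s -> G (T_word (block_word 0 s)).
Proof.
move=> hs ho; have st : perm_eq (sort geq s) s by rewrite perm_sort.
apply: (G_perm (pre := [::]) st); first by rewrite /= (composition_perm st).
have /andP[h1 h2] : composition (sort geq s) by rewrite (composition_perm st).
apply: Godd; last by rewrite (perm_all _ st).
apply/and3P; split => //.
by apply: sort_sorted => x y; apply: leq_total.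
Qed.

(** Splitting an even block increases the number of blocks, which is at most n. *)
Lemma G_plain s : composition s -> G (T_word (block_word 0 s)).
Proof.
have [k hk] := ubnP (n - size s)%N; elim: k s hk => [|k IH] s hk hs //.
have [ho|] := boolP (all odd s); first exact: G_odd.
case/allPn => r /splitPr hr r_even; case: hr hk hs => s1 s2 hk hs.
have /andP[] := hs; rewrite all_cat sumn_cat /= => /and3P[s1p r0 s2p] /eqP hn.
set a := sumn s1 in hn; set L := T_word (block_word 0 s1).
set R := T_word (block_word (a + r) s2).
have hL : supported 0 a false L by apply/supported_T_word; have := block_word_bounds 0 s1p.
have hR : supported (a + r) n false R.
  apply/supported_T_word; have := block_word_bounds (a + r) s2p.
  by rewrite (_ : _ + sumn s2 = n)%N //; lia.
suff : G (L * T_word (iota a r.-1) * R).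
  by rewrite block_word_cat add0n /= !T_word_cat mulrA.
have r1 : (1 < r)%N by case: (r) r0 r_even => [|[]].
apply: (@even_block a r (fun x => G (L * x * R))) => //; first lia.
  split=> [x y gx gy|c x gx|d e x y hx hy].
  - by rewrite mulrDr mulrDl; apply: GD.
  - by rewrite -scalerAr -scalerAl; apply: GZ.
  have Lx z f : supported a (a + r) f z -> L * z = z * L.
    by move=> hz; apply: (supported_comm _ _ _ hL hz) => //; lia.
  have xR z f : supported a (a + r) f z -> z * R = R * z.
    by move=> hz; apply: (supported_comm _ _ _ hz hR); rewrite ?andbF.
  have -> : L * (x * y - y * x) * R = x * (L * y * R) - (L * y * R) * x.
    rewrite mulrBr mulrBl -[L * y * R * x]mulrA -(xR _ _ hx) !mulrA.
    by rewrite (Lx _ _ hx).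
  exact: GC.
move=> j hj.
have hc' : composition (s1 ++ j.+1 :: (r - j.+1)%N :: s2).
  rewrite /composition all_cat sumn_cat /= s1p s2p /=.
  by apply/andP; split; [apply/andP; split|]; lia.
have := IH _ _ hc'; rewrite block_word_cat add0n /= !T_word_cat !mulrA.
have -> : (r - j.+1).-1 = (r.-1 - j.+1)%N by lia.
have -> : (a + j.+1 + (r - j.+1) = a + r)%N by lia.
rewrite addnS; apply; move: hk; rewrite !size_cat /=.
move: (size_le_sumn s1p) (size_le_sumn s2p); rewrite -/a.
by move: (size s1) (size s2) => x1 x2; lia.
Qed.

(** A pair (r, true) stands for a block of length r preceded by the Clifford
    generator of its first position. *)
Fixpoint block_prod (a : nat) (g : seq (nat * bool)) : H :=
  if g is (r, e) :: g' then
    (if e then hc a else 1) * T_word (iota a r.-1) * block_prod (a + r) g'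
  else 1.

Definition dsum (g : seq (nat * bool)) := sumn (unzip1 g).
Definition dpar (g : seq (nat * bool)) := odd (count snd g).
Definition dpos (g : seq (nat * bool)) := all (ltn 0) (unzip1 g).

Lemma supported_block_prod a g : dpos g -> (a + dsum g <= n)%N ->
  supported a (a + dsum g) (dpar g) (block_prod a g).
Proof.
elim: g a => [|[r e] g IH] a; first by move=> _ _; apply: supported1.
rewrite /dpos /dsum /dpar /= => /andP[r0 gp] hn.
rewrite oddD; apply: supportedM; last first.
  apply: (supported_widen (a := (a + r)%N) (b := (a + r + dsum g)%N)); rewrite ?/dsum; try lia.
  by rewrite -/(dpar g); apply: (IH (a + r)%N) => //; rewrite /dsum; lia.
rewrite oddb -[e]addbF; apply: supportedM; last by apply: supported_iota; lia.
by case: e; [apply: supportedC; lia|apply: supported1].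
Qed.

(** The first decorated block x is odd, and so is the product of the other ones:
    the commutator of x with that product is twice the whole, up to sign. *)
Lemma G_has_decorated g a d L : supported 0 a d L -> dpos g -> (a + dsum g = n)%N ->
  has snd g -> d = dpar g -> G (L * block_prod a g).
Proof.
elim: g a d L => [|[r e] g IH] a d L hL //.
rewrite /dpos /dsum /dpar /= => /andP[r0 gp] hn hg dE.
have hU : supported a (a + r) false (T_word (iota a r.-1)) by apply: supported_iota; lia.
case: e hg dE => /= [_|hg] dE; last first.
  rewrite mul1r mulrA; apply: (IH _ d) => //; last by rewrite /dsum; lia.
  apply: (@supportedM_eq _ _ d false); last by rewrite addbF.
    by apply: supported_widen hL; lia.
  by apply: supported_widen hU; lia.
set x := hc a * T_word _; set R := block_prod _ _.
have hx : supported a (a + r) true x.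
  by apply: (@supportedM _ _ true false) => //; apply: supportedC; lia.
have hR : supported (a + r) n (dpar g) R.
  have -> : n = (a + r + dsum g)%N by rewrite /dsum; lia.
  by apply: supported_block_prod => //; rewrite /dsum; lia.
have xR := supported_supercomm (leqnn _) (leqnn n) hx hR.
have Lx : L * x = (-1) ^+ d *: (x * L).
  by rewrite (supported_supercomm (leqnn a) _ hL hx) ?andbT //; lia.
have sgn b y : G ((-1) ^+ b *: y) -> G y.
  by move=> /(GZ ((-1) ^+ b)); rewrite scalerA -expr2 sqrr_sign scale1r.
have xL : x * L = (-1) ^+ d *: (L * x).
  by rewrite Lx scalerA -expr2 sqrr_sign scale1r.
have Rx : R * x = (-1) ^+ dpar g *: (x * R).
  by rewrite xR scalerA -expr2 sqrr_sign scale1r.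
rewrite mulrA; apply: (tr_half trG); apply: (sgn d).
suff <- : x * (L * R) - L * R * x = (-1) ^+ d *: (L * x * R + L * x * R) by [].
rewrite mulrA xL -mulrA Rx -scalerAl -scalerAr !mulrA -scaleNr scalerDr.
by rewrite dE /dpar; case: (odd _); rewrite ?opprK.
Qed.

Lemma G_decorated g : dpos g -> dsum g = n -> ~~ dpar g -> G (block_prod 0 g).
Proof.
move=> gp gn ge; have [hg|hg] := boolP (has snd g).
  by rewrite -[block_prod _ _]mul1r; apply: (G_has_decorated (supported1 0 0)) => //; case: dpar ge.
suff -> : block_prod 0 g = T_word (block_word 0 (unzip1 g)).
  by apply: G_plain; rewrite /composition -/(dpos g) gp -/(dsum g) gn eqxx.
elim: g 0%N hg {gp gn ge} => [|[r e] g IH] a /=; first by rewrite T_word0.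
by rewrite negb_or => /andP[/negbTE -> /IH ->]; rewrite mul1r T_word_cat.
Qed.

Lemma supported00 d x : supported 0 0 d x -> exists r : A, x = if d then 0 else r *: 1.
Proof.
elim=> {d x} [d||i|j|d x y _ [r ->] _ [r' ->]|d c x _ [r ->]|d e x y _ [r ->] _ [r' ->]];
  try lia.
- by exists 0; rewrite scale0r if_same.
- by exists 1; rewrite scale1r.
- by exists (r + r'); case: d; rewrite ?addr0 ?scalerDl.
- by exists (c * r); case: d; rewrite ?scaler0 ?scalerA.
exists (if d || e then 0 else r * r'); case: d; case: e.
- by rewrite mul0r scale0r.
- by rewrite mul0r.
- by rewrite mulr0.
by rewrite -scalerAl mul1r scalerA.
Qed.

(** In H_k T_(k-1) H_k the right factor is carried around to the front, which
    lengthens the current block by one position; in the two other cases the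
    current block is complete. *)
Lemma G_reduce_step k : (k < n)%N ->
  (forall d x g, supported 0 k d x -> dpos g -> (k + dsum g = n)%N -> d = dpar g ->
     G (x * block_prod k g)) ->
  (forall r d x g, (0 < k)%N -> supported 0 k d x -> (0 < r)%N -> dpos g ->
     (k.-1 + r + dsum g = n)%N -> d = dpar g ->
     G (x * T_word (iota k.-1 r.-1) * block_prod (k.-1 + r) g)) ->
  forall r d x g, supported 0 k.+1 d x -> (0 < r)%N -> dpos g ->
    (k + r + dsum g = n)%N -> d = dpar g ->
    G (x * T_word (iota k r.-1) * block_prod (k + r) g).
Proof.
move=> hk hA hT' r d x g /(supported_coset_form hk) hx r0 gp.
elim: hx => {d x} [d|d x hx|d x hx|d e x y k0 hx hy|d x y _ ix _ iy|d c x _ ix] hn hd.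
- by rewrite !mul0r; apply: (tr0 trG).
- have := hA _ _ ((r, false) :: g) hx; rewrite /= mul1r -mulrA; apply=> //.
    by rewrite /dpos /= r0.
  by rewrite /dsum /= addnA.
- have := hA _ _ ((r, true) :: g) hx; rewrite /= !mulrA; apply.
  + by rewrite /dpos /= r0.
  + by rewrite /dsum /= addnA.
  by rewrite -[d]negbK hd.
- set B := T_word _; set D := block_prod _ _.
  have hBD : supported k n (dpar g) (B * D).
    apply: (@supportedM _ _ false); first by apply: supported_iota; lia.
    have -> : n = (k + r + dsum g)%N by [].
    by apply: (supported_widen _ (leqnn _) (supported_block_prod gp _)); lia.
  rewrite -!mulrA (supported_supercomm (leqnn k) (leqnn n) hy hBD) -!scalerAr.
  apply: GZ; rewrite !mulrA; apply: (tr_eq trG (GC _ _)).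
  have := hT' r.+1 _ (y * x) g k0 (supportedM hy hx); rewrite /= !mulrA.
  have -> : iota k.-1 r = k.-1 :: iota k r.-1.
    by case: (r) r0 => // r' _ /=; rewrite prednK.
  have -> : (k.-1 + r.+1 = k + r)%N by lia.
  rewrite T_word_cons !mulrA; apply=> //.
  by rewrite addbC.
- by rewrite !mulrDl; apply: GD; [apply: ix|apply: iy].
by rewrite -!scalerAl; apply: GZ; apply: ix.
Qed.

Lemma G_reduce k r d x g : (k < n)%N -> supported 0 k.+1 d x -> (0 < r)%N -> dpos g ->
  (k + r + dsum g = n)%N -> d = dpar g -> G (x * T_word (iota k r.-1) * block_prod (k + r) g).
Proof.
elim: k r d x g => [|k IH] r d x g hk; apply: G_reduce_step => //.
  move=> {x d} d x {r} g' /supported00[r ->].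
  case: d; first by rewrite mul0r => *; apply: (tr0 trG).
  move=> gp hn hd; rewrite -scalerAl mul1r; apply: GZ; apply: G_decorated => //.
  by rewrite -hd.
- move=> {x d} d x g' hx gp hn hd.
  have := IH 1%N _ _ _ _ hx; rewrite /= T_word0 mulr1 addn1; apply=> //; lia.
by move=> {x d} r' d x g' _ hx r0 gp hn hd; apply: IH hx r0 gp hn hd; lia.
Qed.

Lemma tracial_even x : (0 < n)%N -> supported 0 n false x -> G x.
Proof.
move=> n0 hx; have := @G_reduce n.-1 1 false x [::].
rewrite /= T_word0 !mulr1 prednK //; apply=> //; rewrite /dsum /=; lia.
Qed.

End Reduction.
End Spanning.

(** * The action on functions of words *)
Section Operators.
Variables (P : comNzRingType) (v : P) (m : nat).
Local Notation S := (bool * 'I_m)%type.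
Local Notation q := (v - 1).
Implicit Types (f g : seq S -> P) (s t u : seq S).

Definition flip (x : S) : S := (~~ x.1, x.2).

(** In the induced module, a word s with sign bits e stands for the product of
    the c_j with e_j = 1 applied to the word of letters.  Moving T_i through c_i
    and c_(i+1) gives its action on two adjacent positions x and y; the result
    involves the exchange of x and y, the identity, and the change of both sign
    bits, with the following coefficients. *)
Definition co_swap (x y : S) : P :=
  let al := if (x.2 < y.2)%N then 1 else v in
  if x.1 && y.1 then - al else al.
Definition co_id (x y : S) : P :=
  let be := if (y.2 < x.2)%N then q else 0 in
  if x.1 then (if y.1 then q - be else 0) else (if y.1 then q else be).
Definition co_flip (x y : S) : P :=
  let be := if (y.2 < x.2)%N then q else 0 in
  if x.1 then (if y.1 then 0 else be - q) else (if y.1 then be else q).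

(** The recursion over the word reduces each relation to one between the first
    two or three positions. *)
Fixpoint act_T (i : nat) (f : seq S -> P) (s : seq S) : P :=
  match i, s with
  | 0, x :: y :: t => co_swap x y * f (y :: x :: t)
      + co_id x y * f (x :: y :: t) + co_flip x y * f (flip x :: flip y :: t)
  | i'.+1, x :: t => act_T i' (fun u => f (x :: u)) t
  | _, _ => 0
  end.

Fixpoint act_c (j : nat) (f : seq S -> P) (s : seq S) : P :=
  match j, s with
  | 0, x :: t => f (flip x :: t)
  | j'.+1, x :: t => (-1) ^+ x.1 * act_c j' (fun u => f (x :: u)) t
  | _, _ => 0
  end.

Lemma eq_act_T i f g s : (forall t, size t = size s -> f t = g t) ->
  act_T i f s = act_T i g s.
Proof.
elim: i f g s => [|i IH] f g [|x s] //= h.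
  by case: s h => [|y s] //= h; rewrite !h.
by apply: IH => t ht; apply: h; rewrite /= ht.
Qed.

Lemma eq_act_c j f g s : (forall t, size t = size s -> f t = g t) ->
  act_c j f s = act_c j g s.
Proof.
elim: j f g s => [|j IH] f g [|x s] //= h; first by rewrite h.
by congr (_ * _); apply: IH => t ht; apply: h; rewrite /= ht.
Qed.

Lemma act_T_lin i c d f g s :
  act_T i (fun t => c * f t + d * g t) s = c * act_T i f s + d * act_T i g s.
Proof.
elim: i f g s => [|i IH] f g [|x s] /=; rewrite ?mulr0 ?addr0 //.
by case: s => [|y s]; rewrite ?mulr0 ?addr0 //; ring.
Qed.

Lemma act_c_lin i c d f g s :
  act_c i (fun t => c * f t + d * g t) s = c * act_c i f s + d * act_c i g s.
Proof.
elim: i f g s => [|i IH] f g [|x s] /=; rewrite ?mulr0 ?addr0 //.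
by rewrite IH; ring.
Qed.

Lemma act_T_scale i c f s : act_T i (fun t => c * f t) s = c * act_T i f s.
Proof.
have := act_T_lin i c 0 f f s; rewrite mul0r addr0 => <-.
by apply: eq_act_T => t _; rewrite mul0r addr0.
Qed.

Lemma act_c_scale i c f s : act_c i (fun t => c * f t) s = c * act_c i f s.
Proof.
have := act_c_lin i c 0 f f s; rewrite mul0r addr0 => <-.
by apply: eq_act_c => t _; rewrite mul0r addr0.
Qed.

Lemma act_T_lin3 i c1 c2 c3 f g h s :
  act_T i (fun t => c1 * f t + c2 * g t + c3 * h t) s
  = c1 * act_T i f s + c2 * act_T i g s + c3 * act_T i h s.
Proof.
have := act_T_lin i 1 c3 (fun t => c1 * f t + c2 * g t) h s.
rewrite mul1r (act_T_lin i c1 c2 f g) => <-.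
by apply: eq_act_T => t _; rewrite mul1r.
Qed.

Lemma act_c_lin3 i c1 c2 c3 f g h s :
  act_c i (fun t => c1 * f t + c2 * g t + c3 * h t) s
  = c1 * act_c i f s + c2 * act_c i g s + c3 * act_c i h s.
Proof.
have := act_c_lin i 1 c3 (fun t => c1 * f t + c2 * g t) h s.
rewrite mul1r (act_c_lin i c1 c2 f g) => <-.
by apply: eq_act_c => t _; rewrite mul1r.
Qed.

Lemma act_T_quad i f s : (i.+1 < size s)%N ->
  act_T i (act_T i f) s = q * act_T i f s + v * f s.
Proof.
elim: i f s => [|i IH] f [|x s] //=; last exact: IH.
case: s => [|y s] //= _; case: x y => [[] a] [[] b];
  rewrite /co_swap /co_id /co_flip /flip /=;
  case: (ltngtP a b) => [hab|hab|/val_inj <-]; rewrite ?ltnn /=; ring.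
Qed.

Lemma act_T_comm i j f s : (i.+1 < j)%N ->
  act_T i (act_T j f) s = act_T j (act_T i f) s.
Proof.
elim: i j f s => [|i IH] [|j] f [|x s] //= h; last exact: IH.
case: j h => [|j] // _; case: s => [|y s] //=.
by rewrite act_T_lin3.
Qed.

Lemma act_T_braid i f s : (i.+2 < size s)%N ->
  act_T i (act_T i.+1 (act_T i f)) s = act_T i.+1 (act_T i (act_T i.+1 f)) s.
Proof.
elim: i f s => [|i IH] f [|x s] //=; last exact: IH.
case: s => [|y [|z s]] //= _.
case: x y z => [e a] [d b] [k c]; rewrite /co_swap /co_id /co_flip /flip /=.
(* 8 choices of sign bits times 13 relative orders of the three letters. *)
by case: e; case: d; case: k => /=;
  case: (ltngtP a b) => [hab|hab|/val_inj <-]; rewrite ?ltnn /=;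
  case: (ltngtP a c) => [hac|hac|/val_inj ?]; subst; rewrite ?ltnn /=;
  try (case: (ltngtP b c) => [hbc|hbc|/val_inj ?]; subst; rewrite ?ltnn /=);
  try (exfalso; lia); ring.
Qed.

Lemma act_c_sq j f s : (j < size s)%N -> act_c j (act_c j f) s = f s.
Proof.
elim: j f s => [|j IH] f [|[e a] s] //=; first by rewrite /flip /= negbK.
by rewrite ltnS => h; rewrite act_c_scale IH // mulrA -expr2 sqrr_sign mul1r.
Qed.

Lemma act_c_anti i j f s : (i < j)%N -> act_c i (act_c j f) s = - act_c j (act_c i f) s.
Proof.
elim: i j f s => [|i IH] [|j] f [|x s] //=; rewrite ?oppr0 //.
  by move=> _; rewrite signrN mulNr.
by rewrite ltnS => h; rewrite !act_c_scale IH // !mulrN.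
Qed.

Lemma act_TC_far i j f s : j != i -> j != i.+1 ->
  act_T i (act_c j f) s = act_c j (act_T i f) s.
Proof.
elim: i j f s => [|i IH] [|j] f [|x s] //= h1 h2; last first.
  by rewrite act_T_scale IH.
case: j h1 h2 => [|j] // _ _; case: s => [|y s] /=; first by rewrite mulr0.
rewrite act_c_lin3; case: x y => [[] a] [[] b] /=; ring.
Qed.

Lemma act_TC i f s : (i.+1 < size s)%N ->
  act_T i (act_c i f) s = act_c i.+1 (act_T i f) s.
Proof.
elim: i f s => [|i IH] f [|x s] //; last first.
  by rewrite [LHS]/= act_T_scale => h; rewrite IH.
case: s => [|y s] // _; case: x y => [[] a] [[] b];
  rewrite /= /co_swap /co_id /co_flip /flip /=;
  case: (ltngtP a b) => [hab|hab|/val_inj <-]; rewrite ?ltnn /=; ring.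
Qed.

(** The action preserves the multiset of letters. *)
Lemma act_T_weight i (w : seq S -> P) f s :
  (forall s t, perm_eq (unzip2 s) (unzip2 t) -> w s = w t) ->
  act_T i (fun t => w t * f t) s = w s * act_T i f s.
Proof.
elim: i w f s => [|i IH] w f [|x s] hw /=; rewrite ?mulr0 //; last first.
  apply: (IH (fun u => w (x :: u))) => s1 t1 h.
  by apply: hw; rewrite /= perm_cons.
case: s => [|y s]; rewrite ?mulr0 //.
rewrite (hw (y :: x :: s) (x :: y :: s)).
  rewrite (hw (flip x :: flip y :: s) (x :: y :: s)) //; ring.
by rewrite /= (perm_catCA [:: y.2] [:: x.2]).
Qed.

Lemma act_c_weight i (w : seq S -> P) f s :
  (forall s t, perm_eq (unzip2 s) (unzip2 t) -> w s = w t) ->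
  act_c i (fun t => w t * f t) s = w s * act_c i f s.
Proof.
elim: i w f s => [|i IH] w f [|x s] hw /=; rewrite ?mulr0 //; last first.
  rewrite (IH (fun u => w (x :: u))) => [|s1 t1 h]; first by ring.
  by apply: hw; rewrite /= perm_cons.
by rewrite (hw (flip x :: s) (x :: s)).
Qed.

End Operators.

Lemma act_T_morph (P P' : comNzRingType) (phi : {rmorphism P -> P'}) v m i
   (f : seq (bool * 'I_m) -> P) s :
  phi (act_T v i f s) = act_T (phi v) i (phi \o f) s.
Proof.
elim: i f s => [|i IH] f [|x s] /=; rewrite ?rmorph0 //.
case: s => [|y s]; rewrite ?rmorph0 //.
rewrite !rmorphD !rmorphM /=; congr (_ * _ + _ * _ + _ * _).
- by rewrite /co_swap; case: ifP; case: ifP; rewrite ?(rmorphN, rmorph1).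
- rewrite /co_id; case: x.1; case: y.1; case: (y.2 < x.2)%N;
  by rewrite ?(rmorphB, rmorph0, rmorph1).
rewrite /co_flip; case: x.1; case: y.1; case: (y.2 < x.2)%N;
by rewrite ?(rmorphB, rmorph0, rmorph1).
Qed.

Section Words.
Variables (P : comNzRingType) (v : P) (m : nat).
Local Notation S := (bool * 'I_m)%type.
Implicit Types (f : seq S -> P) (s t : seq S).

Definition act_word (w : seq nat) f := foldr (@act_T P v m) f w.

Lemma act_word_cat w1 w2 f : act_word (w1 ++ w2) f = act_word w1 (act_word w2 f).
Proof. by rewrite /act_word foldr_cat. Qed.

Lemma eq_act_word w f g s : (forall t, size t = size s -> f t = g t) ->
  act_word w f s = act_word w g s.
Proof.
elim: w s => [|i w IH] s h /=; first exact: h.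
by apply: eq_act_T => t ht; apply: IH => u hu; apply: h; rewrite hu.
Qed.

Lemma act_word_shift r w f s t : size s = r ->
  act_word (map (addn r) w) f (s ++ t) = act_word w (fun u => f (s ++ u)) t.
Proof.
move=> <-; elim: w t => [|i w IH] t //=.
transitivity (act_T v i (fun u => act_word (map (addn (size s)) w) f (s ++ u)) t).
  elim: s (act_word _ f) {IH} => [|x s IHs] F //=.
by apply: eq_act_T => u _; apply: IH.
Qed.

End Words.

Lemma act_word_morph (P P' : comNzRingType) (phi : {rmorphism P -> P'}) v m w
   (f : seq (bool * 'I_m) -> P) s :
  phi (act_word v w f s) = act_word (phi v) w (phi \o f) s.
Proof.
elim: w s => [|i w IH] s //=.
by rewrite act_T_morph; apply: eq_act_T => t _ /=.
Qed.

Lemma block_word_shift a r g : block_word (r + a) g = map (addn r) (block_word a g).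
Proof.
elim: g a => [|k g IH] a //=.
by rewrite map_cat -IH addnA iotaDl.
Qed.

(** * Specialisation at v = 1 *)
Section Classical.
Variables (P : comNzRingType) (m : nat).
Local Notation S := (bool * 'I_m)%type.
Implicit Types (f : seq S -> P) (s t : seq S).

Definition koszul (x : S) (t : seq S) : P := \prod_(y <- t) (-1) ^+ (x.1 && y.1).

Lemma act_T1 f x y t :
  act_T (1 : P) 0 f (x :: y :: t) = (-1) ^+ (x.1 && y.1) * f (y :: x :: t).
Proof.
rewrite /= /co_swap /co_id /co_flip subrr !if_same !subr0 !if_same.
by rewrite !mul0r !addr0; case: ifP.
Qed.

(** A chain rotates a block, with the sign of moving x past s. *)
Lemma act_word_chain x s t f :
  act_word (1 : P) (iota 0 (size s)) f (x :: s ++ t) = koszul x s * f (s ++ x :: t).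
Proof.
elim: s f => [|y s IH] f; first by rewrite /koszul big_nil mul1r.
rewrite -[LHS]/(act_T 1 0 (act_word 1 (iota 1 (size s)) f) (x :: y :: (s ++ t))) act_T1.
have -> : iota 1 (size s) = map (addn 1) (iota 0 (size s)) by rewrite -iotaDl.
rewrite (act_word_shift (r := 1) _ _ f (s := [:: y])) // IH /koszul big_cons.
by rewrite mulrA.
Qed.

(** The words fixed by the rotations of all blocks. *)
Fixpoint block_const (g : seq nat) (s : seq S) : bool :=
  match g, s with
  | r :: g', x :: s' => (take r.-1 s' == nseq r.-1 x) && block_const g' (drop r.-1 s')
  | [::], [::] => true
  | _, _ => false
  end.

Definition delta (s t : seq S) : P := (t == s)%:R.

Lemma rcons_nseq (x : S) s : (rcons s x == x :: s) = (s == nseq (size s) x).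
Proof.
elim: s => [|y s IH] /=; first by rewrite !eqxx.
rewrite !eqseq_cons; case: eqP => //= ->; exact: IH.
Qed.

Lemma act_word_scale w c f s : act_word (1 : P) w (fun t => c * f t) s = c * act_word 1 w f s.
Proof.
elim: w s => [|i w IH] s //=; rewrite -act_T_scale.
by apply: eq_act_T => t _; apply: IH.
Qed.

(** Rotating a constant block of r letters moves one letter past r-1 equal ones,
    hence without sign when r is odd. *)
Lemma act_word_block_diag g s : all odd g -> sumn g = size s ->
  act_word (1 : P) (block_word 0 g) (delta s) s = (block_const g s)%:R.
Proof.
elim: g s => [|r g IH] s /=; first by case: s => //= _ _; rewrite /delta eqxx.
case/andP; case: s => [|x s] /=; first by case: r.
case: r => // r; rewrite [r.+1.-1]/= => ro go [hr].
have [s1 [t [es er]]] : exists s1 t, s = s1 ++ t /\ size s1 = r.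
  by exists (take r s), (drop r s); rewrite cat_take_drop size_takel //; lia.
subst r s; rewrite take_size_cat // drop_size_cat //.
rewrite act_word_cat act_word_chain -cat_rcons add0n -[(size s1).+1]addn0 block_word_shift.
rewrite act_word_shift ?size_rcons //.
transitivity (koszul x s1 * ((rcons s1 x == x :: s1)%:R
                * act_word (1 : P) (block_word 0 g) (delta t) t)).
  congr (_ * _); rewrite -act_word_scale; apply: eq_act_word => u hu.
  rewrite /delta -cat_cons eqseq_cat ?size_rcons //.
  by case: (_ == _); rewrite /= ?mul1r ?mul0r.
rewrite rcons_nseq IH //; last by move: hr; rewrite size_cat; lia.
have [e|] := eqVneq; last by rewrite !(mul0r, mulr0).
rewrite /= mul1r /koszul e -[RHS]mul1r; congr (_ * _).
rewrite big_nseq iter_mulr_1 andbb -exprM -signr_odd oddM /=.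
by move: ro; rewrite /= => /negbTE ->; rewrite andbF.
Qed.
End Classical.

(** * From operators to matrices and traces *)
Section LocalOperators.
Variables (P : comNzRingType) (S : finType) (n : nat).
Local Notation N := #|{: n.-tuple S}|.
Implicit Types (F G : (seq S -> P) -> seq S -> P) (f g : seq S -> P).

Definition local_op F :=
  (forall f g s, (forall t, size t = size s -> f t = g t) -> F f s = F g s) /\
  (forall c d f g s, F (fun t => c * f t + d * g t) s = c * F f s + d * F g s).

Definition tup (j : 'I_N) : n.-tuple S := enum_val j.

Definition mxop F : 'M[P]_N :=
  \matrix_(i, j) F (fun t => (t == tup j :> seq S)%:R) (tup i).

Lemma local_op_expand F f (s : seq S) : local_op F -> size s = n ->
  F f s = \sum_(j < N) F (fun t => (t == tup j :> seq S)%:R) s * f (tup j).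
Proof.
move=> [Feq Flin] hs.
have F0 : F (fun _ => 0) s = 0.
  transitivity (F (fun _ => 0 * 0 + 0 * 0) s).
    by apply: Feq => t _; rewrite mul0r addr0.
  by rewrite (Flin 0 0 (fun _ => 0) (fun _ => 0)) !mul0r addr0.
have Fsum (I : Type) (r : seq I) (c : I -> P) (h : I -> seq S -> P) :
    F (fun t => \sum_(i <- r) c i * h i t) s = \sum_(i <- r) c i * F (h i) s.
  elim: r => [|i r IH].
    by rewrite big_nil -[RHS]F0; apply: Feq => t _; rewrite big_nil.
  rewrite big_cons -IH -[X in _ = _ + X]mul1r -Flin; apply: Feq => t _.
  by rewrite big_cons mul1r.
under eq_bigr do rewrite mulrC.
rewrite -Fsum; apply: Feq => t ht.
have ht' : size t == n by rewrite ht hs.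
rewrite (bigD1 (enum_rank (Tuple ht'))) //= /tup enum_rankK eqxx mulr1 big1 ?addr0 //.
move=> j hj; case: eqP => [e|]; last by rewrite mulr0.
case/eqP: hj; apply: enum_val_inj; rewrite enum_rankK; exact/esym/val_inj.
Qed.

Lemma mxop_comp F G : local_op F -> mxop (fun f => F (G f)) = mxop F *m mxop G.
Proof.
move=> lF; apply/matrixP => i j; rewrite !mxE.
rewrite (local_op_expand _ lF) ?size_tuple //.
by apply: eq_bigr => k _; rewrite !mxE.
Qed.

Lemma eq_mxop F G : (forall f s, size s = n -> F f s = G f s) -> mxop F = mxop G.
Proof. by move=> h; apply/matrixP => i j; rewrite !mxE h // size_tuple. Qed.

Lemma mxop_id : mxop (fun f => f) = 1%:M.
Proof.
apply/matrixP => i j; by rewrite !mxE -(inj_eq (@enum_val_inj _ _)) -(inj_eq val_inj).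
Qed.

Lemma mxop_lin c d F G : mxop (fun f s => c * F f s + d * G f s)
  = c *: mxop F + d *: mxop G.
Proof. by apply/matrixP => i j; rewrite !mxE. Qed.

Lemma mxtrace_op F : \tr (mxop F) =
  \sum_(x : n.-tuple S) F (fun t => (t == x :> seq S)%:R) x.
Proof.
rewrite (reindex (fun i : 'I_N => enum_val i)) /=; last first.
  by apply: onW_bij; apply: enum_val_bij.
by apply: eq_bigr => i _; rewrite mxE.
Qed.

End LocalOperators.

(** * Representations of presented algebras *)
Section FreeAlgRep.
Variables (K : comNzRingType) (X : choiceType) (N : nat) (G : X -> 'M[K]_N).
Local Notation F := (free_alg K X).

Definition word_mx (w : {fmonom X}) : 'M[K]_N := \prod_(l <- (w : seq X)) G l.

Lemma word_mx1 : word_mx (@mone _) = 1.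
Proof. by rewrite /word_mx fm1 big_nil. Qed.

Lemma word_mxM (w1 w2 : {fmonom X}) :
  word_mx (mmul w1 w2) = word_mx w1 * word_mx w2.
Proof. by rewrite /word_mx fmM big_cat. Qed.

Definition free_rep (x : F) : 'M[K]_N := \sum_(w <- msupp x) mcoeff w x *: word_mx w.

Lemma free_repEw (d : {fset {fmonom X}}) x : (msupp x `<=` d)%fset ->
  free_rep x = \sum_(w <- d) mcoeff w x *: word_mx w.
Proof.
move=> le; rewrite [LHS](big_fset_incl _ le) => //= w xd /mcoeff_outdom ->.
by rewrite scale0r.
Qed.

Lemma free_repU (c : K) (w : {fmonom X}) : free_rep (mkmalgU w c) = c *: word_mx w.
Proof. by rewrite (free_repEw msuppU_le) big_seq_fset1 mcoeffUU. Qed.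

Lemma free_repB x y : free_rep (x - y) = free_rep x - free_rep y.
Proof.
have h1 := fsubsetUl (msupp x) (msupp y); have h2 := fsubsetUr (msupp x) (msupp y).
rewrite (free_repEw h1) (free_repEw h2) (free_repEw (msuppB_le x y)) -sumrB.
by apply: eq_bigr => w _; rewrite mcoeffB scalerBl.
Qed.

HB.instance Definition _ := GRing.isZmodMorphism.Build F 'M[K]_N free_rep free_repB.

Lemma free_repM x y : free_rep (x * y) = free_rep x * free_rep y.
Proof.
rewrite malgME raddf_sum mulr_suml /=; apply: eq_bigr => i _.
rewrite raddf_sum mulr_sumr /=; apply: eq_bigr => j _.
by rewrite free_repU word_mxM -mulmxE -scalemxAl -scalemxAr scalerA.
Qed.

Lemma free_rep1 : free_rep 1 = 1.
Proof. by rewrite free_repU word_mx1 scale1r. Qed.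

Lemma free_repC c : free_rep c%:MP = c *: (1 : 'M[K]_N).
Proof. by rewrite free_repU word_mx1. Qed.

Lemma free_repZ c x : free_rep (c *: x) = c *: free_rep x.
Proof. by rewrite -mul_malgC free_repM free_repC -mulmxE -scalemxAl mul1mx. Qed.

Lemma free_rep_letter l : free_rep (letter K l) = G l.
Proof. by rewrite free_repU scale1r /word_mx fmU big_seq1. Qed.

Lemma free_repD x y : free_rep (x + y) = free_rep x + free_rep y.
Proof. exact: raddfD. Qed.

Lemma free_repB0 x y : free_rep x = free_rep y -> free_rep (x - y) = 0.
Proof. by move=> h; apply: etrans (free_repB _ _) _; rewrite h subrr. Qed.

Lemma free_rep_mul2 a b : free_rep (letter K a * letter K b) = G a *m G b.
Proof.
apply: etrans (free_repM _ _) _.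
exact: (congr2 mulmx (free_rep_letter a) (free_rep_letter b)).
Qed.

Lemma free_rep_mul3 a b c :
  free_rep (letter K a * letter K b * letter K c) = G a *m G b *m G c.
Proof.
apply: etrans (free_repM _ _) _.
exact: (congr2 mulmx (free_rep_mul2 a b) (free_rep_letter c)).
Qed.

Lemma free_rep_rel2 a b c d : G a *m G b = G c *m G d ->
  free_rep (letter K a * letter K b - letter K c * letter K d) = 0.
Proof.
move=> h; apply: free_repB0; apply: etrans (free_rep_mul2 _ _) _.
exact: etrans h (esym (free_rep_mul2 _ _)).
Qed.

Lemma free_rep_rel3 a b c d e f : G a *m G b *m G c = G d *m G e *m G f ->
  free_rep (letter K a * letter K b * letter K c
            - letter K d * letter K e * letter K f) = 0.
Proof.
move=> h; apply: free_repB0; apply: etrans (free_rep_mul3 _ _ _) _.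
exact: etrans h (esym (free_rep_mul3 _ _ _)).
Qed.

Lemma free_rep_rel_anti a b c d : G a *m G b = - (G c *m G d) ->
  free_rep (letter K a * letter K b + letter K c * letter K d) = 0.
Proof.
move=> h; apply: etrans (free_repD _ _) _.
apply: etrans (congr2 +%R (free_rep_mul2 a b) (free_rep_mul2 c d)) _.
by rewrite h addNr.
Qed.

Lemma free_rep_rel_sq a : G a *m G a = 1%:M -> free_rep (letter K a ^+ 2 - 1) = 0.
Proof.
move=> h; apply: free_repB0; apply: etrans (free_rep_mul2 _ _) _.
exact: etrans h (esym free_rep1).
Qed.

Lemma free_rep_rel_quad (q : K) a : G a *m G a = (q - 1) *: G a + q *: 1%:M ->
  free_rep ((letter K a - q%:MP) * (letter K a + 1)) = 0.
Proof.
move=> h; apply: etrans (free_repM _ _) _.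
have e1 : free_rep (letter K a - q%:MP) = G a - q *: 1%:M.
  apply: etrans (free_repB _ _) _.
  exact: (congr2 (fun x y => x - y) (free_rep_letter a) (free_repC q)).
have e2 : free_rep (letter K a + 1) = G a + 1%:M.
  apply: etrans (free_repD _ _) _.
  exact: (congr2 +%R (free_rep_letter a) free_rep1).
rewrite e1 e2 -mulmxE mulmxDr mulmxBl mulmx1 h -scalemxAl mul1mx.
rewrite scalerBl scale1r -[G a - _]opprB.
have -> : q *: G a - G a + q *: 1%:M = q *: G a + (q *: 1%:M - G a).
  by rewrite addrA addrAC.
by rewrite -addrA -opprD subrr.
Qed.

Lemma free_rep_comm (Q : 'M[K]_N) x : (forall l, G l *m Q = Q *m G l) ->
  free_rep x *m Q = Q *m free_rep x.
Proof.
move=> hQ; rewrite mulmx_suml mulmx_sumr; apply: eq_bigr => w _.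
rewrite -scalemxAl -scalemxAr; congr (_ *: _); rewrite /word_mx.
elim: (w : seq X) => [|l s IH]; first by rewrite big_nil mul1mx mulmx1.
by rewrite big_cons -!mulmxE -mulmxA IH !mulmxA hQ.
Qed.

Section Presented.
Variable rel : F -> Prop.
Hypothesis rel0 : forall r, rel r -> free_rep r = 0.

Lemma ideal_rep0 x : x \in ideal_pred rel -> free_rep x = 0.
Proof.
move=> /asboolP; elim=> {x} [r /rel0 //||x y _ hx _ hy|a x b _ hx].
- exact: raddf0.
- by rewrite raddfB /= hx hy subr0.
by rewrite !free_repM hx mulr0 mul0r.
Qed.

(** The chosen representative does not matter, by [ideal_rep0]. *)
Definition rep (h : presented rel) : 'M[K]_N := free_rep (presented_repr h).

Lemma rep_pi x : rep (presented_pi rel x) = free_rep x.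
Proof.
apply/eqP; rewrite -subr_eq0 -free_repB; apply/eqP/ideal_rep0.
by apply/presented_eqP; rewrite presented_reprK.
Qed.

Lemma repM h h' : rep (h * h') = rep h * rep h'.
Proof.
elim/presented_ind: h => x; elim/presented_ind: h' => y.
by rewrite -presented_piM !rep_pi free_repM.
Qed.

Lemma rep1 : rep 1 = 1.
Proof. by rewrite -presented_pi1 rep_pi free_rep1. Qed.

Lemma repB h h' : rep (h - h') = rep h - rep h'.
Proof.
elim/presented_ind: h => x; elim/presented_ind: h' => y.
by rewrite -raddfB !rep_pi free_repB.
Qed.

Lemma repZ c h : rep (c *: h) = c *: rep h.
Proof. by elim/presented_ind: h => x; rewrite -presented_piZ !rep_pi free_repZ. Qed.

End Presented.
End FreeAlgRep.

(** * The module of functions of words, and its traces *)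
Section HeckeCliffordRep.
Variables (K : fieldType) (v : K) (n m : nat).
Local Notation S := (bool * 'I_m)%type.

Lemma act_T_local i : local_op (@act_T K v m i).
Proof. by split=> *; [apply: eq_act_T|apply: act_T_lin]. Qed.

Lemma act_c_local i : local_op (@act_c K m i).
Proof. by split=> *; [apply: eq_act_c|apply: act_c_lin]. Qed.

Definition gen_mx (l : hc_gen n) : 'M[K]_#|{: n.-tuple S}| :=
  match l with
  | inl i => mxop n (@act_T K v m i)
  | inr j => mxop n (@act_c K m j)
  end.
Local Notation rho := (free_rep gen_mx).

Lemma hc_rel_rep r : hc_rel v r -> rho r = 0.
Proof.
have cT i (F : (seq S -> K) -> seq S -> K) :
    mxop n (fun f => act_T v i (F f)) = mxop n (@act_T K v m i) *m mxop n F.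
  exact/mxop_comp/act_T_local.
have cC i (F : (seq S -> K) -> seq S -> K) :
    mxop n (fun f => act_c i (F f)) = mxop n (@act_c K m i) *m mxop n F.
  exact/mxop_comp/act_c_local.
case=> {r} [i|i j|i j hj|j|i j hij|i j h1 h2|i].
- apply: free_rep_rel_quad; rewrite /= -cT -mxop_id -mxop_lin.
  by apply: eq_mxop => f s hs; apply: act_T_quad; rewrite hs -ltn_predRL.
- move=> hij; apply: free_rep_rel2; rewrite /= -!cT; apply: eq_mxop => f s hs.
  by case/orP: hij => h; [|symmetry]; apply: act_T_comm.
- apply: free_rep_rel3; rewrite /= -!mulmxA -!cT; apply: eq_mxop => f s hs.
  by rewrite hj; apply: act_T_braid; rewrite hs -ltn_predRL -hj.
- apply: free_rep_rel_sq; rewrite /= -cC -mxop_id; apply: eq_mxop => f s hs.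
  by apply: act_c_sq; rewrite hs.
- apply: free_rep_rel_anti; rewrite /= -!cC; apply/matrixP => a b; rewrite !mxE.
  rewrite -val_eqE neq_ltn in hij; case/orP: hij => h; first exact: act_c_anti.
  by rewrite [in RHS]act_c_anti // opprK.
- apply: free_rep_rel2; rewrite /= -cT -cC; apply: eq_mxop => f s hs.
  by apply: act_TC_far; rewrite // -val_eqE in h1 h2 *.
apply: free_rep_rel2; rewrite /gen_mx -cT -cC; apply: eq_mxop => f s hs.
by apply: (@act_TC K v m i); rewrite hs -ltn_predRL.
Qed.

Definition hc_rep (h : hecke_clifford v n) : 'M[K]_#|{: n.-tuple S}| := rep gen_mx h.

Lemma hc_repM h h' : hc_rep (h * h') = hc_rep h *m hc_rep h'.
Proof. exact: (repM hc_rel_rep). Qed.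

Lemma hc_rep1 : hc_rep 1 = 1%:M.
Proof. exact: (rep1 hc_rel_rep). Qed.

Lemma hc_repB h h' : hc_rep (h - h') = hc_rep h - hc_rep h'.
Proof. exact: (repB hc_rel_rep). Qed.

Lemma hc_repZ c h : hc_rep (c *: h) = c *: hc_rep h.
Proof. exact: (repZ hc_rel_rep). Qed.

Lemma hc_rep_T i : hc_rep (hc_T v i) = mxop n (@act_T K v m i).
Proof. exact: etrans (rep_pi hc_rel_rep _) (free_rep_letter _ _). Qed.

Lemma hc_rep_comm (Q : 'M[K]_#|{: n.-tuple S}|) h :
  (forall l, gen_mx l *m Q = Q *m gen_mx l) -> hc_rep h *m Q = Q *m hc_rep h.
Proof. by move=> hQ; apply: free_rep_comm. Qed.

End HeckeCliffordRep.

Section HANontrivial.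
Variables (K : fieldType) (v : K) (n : nat).

(** The algebra is nonzero because it acts on a nonzero module; this makes it an
    [algType], as needed for the results on spanning. *)
Lemma HA_one_neq0 : (1 : HA v n) != 0.
Proof.
apply/eqP => h; have : hc_rep 1 (HA_val (1 : HA v n)) = 0.
  by rewrite h -(subrr 0) hc_repB subrr.
rewrite hc_rep1 => /matrixP e.
have x : 'I_#|{: n.-tuple (bool * 'I_1)}|.
  by apply: enum_rank; exact: [tuple (false, ord0) | i < n].
by have := e x x; rewrite !mxE eqxx => /eqP; rewrite oner_eq0.
Qed.

HB.instance Definition _ :=
  GRing.PzSemiRing_isNonZero.Build (HA v n) HA_one_neq0.
HB.instance Definition _ :=
  GRing.LSemiModule_isLSemiAlgebra.Build (Aring v) (HA v n) (@HA_scalerAl K v n).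
HB.instance Definition _ :=
  GRing.LSemiAlgebra_isSemiAlgebra.Build (Aring v) (HA v n) (@HA_scalerAr K v n).
End HANontrivial.

Section Words.
Variables (K : fieldType) (v : K) (n : nat).
Local Notation T := (HA_T v n).

(** The indices selected in the product over 'I_(n-1) form an interval. *)
Lemma T_blockE a k : (a + k <= n)%N -> T_block v n a k = \prod_(i <- iota a k.-1) T i.
Proof.
move=> hk; rewrite /T_block.
rewrite (eq_bigr (fun i : 'I_n.-1 => T i)) => [|i _]; last by rewrite HA_T_ord.
rewrite -(big_mkord (fun i => (a <= i)%N && (i.+1 < a + k)%N) T).
have [ha|ha] := leqP n.-1 a.
  have -> : k.-1 = 0%N by lia.
  rewrite big_nil big_nat_cond big_pred0 // => i; lia.
rewrite (big_cat_nat _ (n := a)) //=; last lia.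
rewrite big_nat_cond big_pred0 => [|i]; last lia.
rewrite mul1r (big_cat_nat _ (n := (a + k.-1)%N)) //=; try lia.
rewrite [X in _ * X]big_nat_cond [X in _ * X]big_pred0 => [|i]; last lia.
rewrite mulr1 big_nat_cond.
rewrite (eq_bigl (fun i => (a <= i < a + k.-1)%N)) => [|i]; last lia.
by rewrite -big_nat /index_iota addKn.
Qed.

Lemma T_compE g : all (ltn 0) g -> (sumn g <= n)%N ->
  T_comp v n g = \prod_(i <- block_word 0 g) T i.
Proof.
rewrite /T_comp => gp.
suff h a : (a + sumn g <= n)%N ->
    \prod_(j < size g) T_block v n (a + sumn (take j g)) (nth 0%N g j)
    = \prod_(i <- block_word a g) T i by move=> hn; rewrite -h.
elim: g a gp => [|r g IH] a /=; first by rewrite big_ord0 big_nil.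
case/andP=> r0 gp hn; rewrite big_ord_recl /= addn0 big_cat T_blockE; last lia.
congr (_ * _); rewrite -IH //; last lia.
by apply: eq_bigr => j _; rewrite addnA.
Qed.

End Words.

Section Trace.
Variables (K : fieldType) (v : K) (n m : nat).
Local Notation S := (bool * 'I_m)%type.
Local Notation T := (HA_T v n).

Definition content (lam : seq nat) (s : seq S) : bool :=
  [forall k : 'I_m, count_mem k (unzip2 s) == nth 0%N lam k].

Lemma content_perm lam s t : perm_eq (unzip2 s) (unzip2 t) ->
  content lam s = content lam t.
Proof.
by move=> /seq.permP h; apply: eq_forallb => k; rewrite h.
Qed.

Definition content_proj lam (f : seq S -> K) s := (content lam s)%:R * f s.

Lemma content_local lam : local_op (content_proj lam).
Proof.
split=> [f g s h|c d f g s]; first by rewrite /content_proj h.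
by rewrite /content_proj mulrDr !mulrA ![_%:R * _]mulrC.
Qed.

(** The trace over the words of content lam. *)
Definition chi lam (h : HA v n) : K :=
  \tr (hc_rep m (HA_val h) *m mxop n (content_proj lam)).

(** The projection onto content lam commutes with the action. *)
Lemma chi_comm lam h h' : chi lam (h * h') = chi lam (h' * h).
Proof.
have eM (x y : HA v n) : hc_rep m (HA_val (x * y))
    = hc_rep m (HA_val x) *m hc_rep m (HA_val y) by exact: hc_repM.
pose tr Q := \tr (Q *m mxop n (content_proj lam)).
apply: etrans (congr1 tr (eM h h')) _; apply: etrans _ (congr1 tr (esym (eM h' h))).
rewrite /tr -mulmxA mxtrace_mulC -!mulmxA.
congr (\tr (_ *m _)); apply/esym/hc_rep_comm => l.
have wP (s t : seq S) : perm_eq (unzip2 s) (unzip2 t) ->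
    (content lam s)%:R = (content lam t)%:R :> K.
  by move=> /(content_perm lam) ->.
case: l => [i|j]; rewrite /gen_mx.
  rewrite -mxop_comp; last exact: act_T_local.
  rewrite -mxop_comp; last exact: content_local.
  by apply: eq_mxop => f s _; apply: act_T_weight.
rewrite -mxop_comp; last exact: act_c_local.
rewrite -mxop_comp; last exact: content_local.
by apply: eq_mxop => f s _; apply: act_c_weight.
Qed.

Lemma chiB lam h h' : chi lam (h - h') = chi lam h - chi lam h'.
Proof.
have e : hc_rep m (HA_val (h - h')) = hc_rep m (HA_val h) - hc_rep m (HA_val h').
  exact: hc_repB.
by rewrite /chi e mulmxBl raddfB.
Qed.

Lemma chiZ lam a h : chi lam (a *: h) = A_val a * chi lam h.
Proof.
have e : hc_rep m (HA_val (a *: h)) = A_val a *: hc_rep m (HA_val h).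
  exact: hc_repZ.
by rewrite /chi e -scalemxAl mxtraceZ.
Qed.

Lemma chi0 lam : chi lam 0 = 0.
Proof. by have := chiB lam 0 0; rewrite subrr subrr. Qed.

Lemma chiD lam h h' : chi lam (h + h') = chi lam h + chi lam h'.
Proof.
have e : chi lam (- h') = - chi lam h' by rewrite -sub0r chiB chi0 sub0r.
by rewrite -{1}[h']opprK chiB e opprK.
Qed.

Lemma chi_sum lam (I : Type) (r : seq I) (F : I -> HA v n) :
  chi lam (\sum_(i <- r) F i) = \sum_(i <- r) chi lam (F i).
Proof.
by elim: r => [|i r IH]; rewrite ?big_nil ?chi0 // !big_cons chiD IH.
Qed.

Lemma chi_commutators lam x : in_commutators x -> chi lam x = 0.
Proof.
case=> s ->; rewrite chi_sum big1 // => p _.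
by rewrite chiZ chiB chi_comm subrr mulr0.
Qed.

Lemma chi_word lam w : all (fun i => i.+1 < n)%N w ->
  chi lam (\prod_(i <- w) T i)
  = \sum_(x : n.-tuple S) (content lam x)%:R *
      act_word v w (fun t => (t == x :> seq S)%:R) x.
Proof.
move=> hw; rewrite /chi.
have -> : hc_rep m (HA_val (\prod_(i <- w) T i)) = mxop n (@act_word K v m w).
  elim: w hw => [_|i w IH /= /andP[hi /IH {}IH]].
    by rewrite big_nil hc_rep1 mxop_id.
  have hi' : (i < n.-1)%N by lia.
  have eT : hc_rep m (HA_val (T i)) = mxop n (@act_T K v m i).
    by have := HA_T_ord v (Ordinal hi') => /= ->; rewrite hc_rep_T.
  rewrite big_cons; apply: etrans (hc_repM _ _ _) _.
  apply: etrans (congr2 mulmx eT IH) _.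
  exact/esym/(mxop_comp n (@act_word K v m w))/act_T_local.
rewrite -mxop_comp; last first.
  split=> [f g s h|c d f g s]; first exact: eq_act_word.
  elim: w s {hw} => [|i w IH] s //=.
  by rewrite -act_T_lin; apply: eq_act_T => t _; apply: IH.
rewrite mxtrace_op; apply: eq_bigr => x _; rewrite /content_proj.
suff h d s : act_word v w (fun t => (content lam t)%:R * d t) s
    = (content lam s)%:R * act_word v w d s by apply: h.
elim: w s {hw} => [|i w IH] s //=.
rewrite -(@act_T_weight K v m i (fun u => (content lam u)%:R)) =>
  [|s1 s2 /(content_perm lam) -> //].
by apply: eq_act_T => t _; apply: IH.
Qed.

End Trace.

(** * Words constant on blocks, and refinement of partitions *)
Section Combinatorics.
Variable m : nat.
Local Notation S := (bool * 'I_m)%type.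

(** How often the letter k occurs in the word with blocks of lengths g and
    letters ks. *)
Definition mass (g : seq nat) (ks : seq 'I_m) (k : 'I_m) : nat :=
  \sum_(p <- zip g ks) p.1 * (p.2 == k).

Lemma mass_cons r g a ks k :
  mass (r :: g) (a :: ks) k = (r * (a == k) + mass g ks k)%N.
Proof. by rewrite /mass /= big_cons. Qed.

Lemma mass_notin g ks k : k \notin ks -> mass g ks k = 0%N.
Proof.
elim: ks g => [|a ks IH] [|r g]; rewrite ?/mass ?big_nil //.
rewrite inE negb_or -/(mass _ _ _) => /andP[h1 h2].
by rewrite mass_cons eq_sym (negbTE h1) muln0 IH.
Qed.

(** Distinct blocks carrying distinct letters, the masses of the letters are the
    lengths of the blocks. *)
Lemma map_mass g ks : size g = size ks -> uniq ks -> map (mass g ks) ks = g.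
Proof.
elim: g ks => [|r g IH] [|a ks] //= [hs] /andP[ha hu].
rewrite mass_cons eqxx muln1 mass_notin // addn0; congr (_ :: _).
rewrite -[RHS](IH ks) //; apply/eq_in_map => b hb; rewrite mass_cons.
by case: eqP hb ha => [-> ->|] //; rewrite muln0.
Qed.

Lemma block_const_mass g (s : seq S) : all (ltn 0) g -> block_const g s ->
  exists2 ks, size g = size ks &
    forall k, count_mem k (unzip2 s) = mass g ks k.
Proof.
elim: g s => [|r g IH] [|x s] //=; first by exists [::] => // k; rewrite /mass big_nil.
case/andP=> r0 gp /andP[/eqP hr /(IH _ gp)[ks hs hk]].
exists (x.2 :: ks) => [|k]; first by rewrite /= hs.
rewrite mass_cons -hk -{1}(cat_take_drop r.-1 s) hr /unzip2 map_cat count_cat.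
rewrite map_nseq count_nseq /= addnA; congr (_ + _)%N.
by case: (x.2 == k); lia.
Qed.

Definition const_word (g : seq nat) (ks : seq 'I_m) : seq S :=
  flatten [seq nseq p.1 (false, p.2) | p <- zip g ks].

Lemma size_const_word g ks : size g = size ks -> size (const_word g ks) = sumn g.
Proof.
rewrite /const_word; elim: g ks => [|r g IH] [|a ks] //= [hs].
by rewrite size_cat size_nseq IH.
Qed.

Lemma block_const_word g ks : size g = size ks -> all (ltn 0) g ->
  block_const g (const_word g ks).
Proof.
rewrite /const_word; elim: g ks => [|[|r] g IH] [|a ks] //= [hs] gp.
by rewrite take_size_cat ?drop_size_cat ?size_nseq // eqxx IH.
Qed.

Lemma const_word_mass g ks k : size g = size ks ->
  count_mem k (unzip2 (const_word g ks)) = mass g ks k.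
Proof.
rewrite /const_word; elim: g ks => [|r g IH] [|a ks] //=; first by rewrite /mass big_nil.
case=> hs; rewrite /unzip2 map_cat count_cat map_nseq count_nseq -/(unzip2 _).
by rewrite IH // mass_cons mulnC.
Qed.

Lemma mass_ord (lam : seq nat) (k : 'I_m) (hm : (size lam <= m)%N) :
  mass lam [seq widen_ord hm i | i <- enum 'I_(size lam)] k = nth 0%N lam k.
Proof.
set ks := map _ _.
have hsz : size lam = size ks by rewrite size_map size_enum_ord.
have hu : uniq ks.
  by rewrite map_inj_uniq ?enum_uniq // => i j /(congr1 val) /= /val_inj.
have [hk|hk] := ltnP k (size lam); last first.
  rewrite nth_default // mass_notin //; apply/mapP => -[i _ e].
  by have := ltn_ord i; rewrite e /= in hk; lia.
have ek : nth k ks k = k.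
  rewrite (nth_map (Ordinal hk)) ?size_enum_ord //.
  by apply: val_inj; rewrite /= nth_enum_ord.
rewrite -{2}(map_mass hsz hu) (nth_map k) -?hsz //.
by rewrite ek.
Qed.

(** Each letter below size lam has positive mass, hence occurs in ks; when the
    sizes agree, each occurs exactly once, and nu lists its masses. *)
Lemma mass_partition (lam nu : seq nat) (ks : seq 'I_m) :
  (size lam <= m)%N -> all (ltn 0) lam -> size nu = size ks ->
  (forall k : 'I_m, mass nu ks k = nth 0%N lam k) ->
  (size lam <= size nu)%N /\ (size lam = size nu -> perm_eq nu lam).
Proof.
move=> hm lp hs hk; set L := [seq widen_ord hm i | i <- enum 'I_(size lam)].
have hL : size lam = size L by rewrite size_map size_enum_ord.
have hu : uniq L.
  by rewrite map_inj_uniq ?enum_uniq // => i j /(congr1 val) /= /val_inj.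
have sub : {subset L <= ks}.
  move=> _ /mapP[i _ ->]; apply: contraT => /(mass_notin nu).
  rewrite hk /= => e; have := all_nthP 0%N lp i (ltn_ord i).
  by rewrite /= e.
split; first by rewrite hL hs; apply: uniq_leq_size.
move=> hsz; have hle : (size ks <= size L)%N by rewrite -hL -hs hsz.
have [_ hE] := uniq_min_size hu sub hle.
have ua := leq_size_uniq hu sub hle.
rewrite -{1}(map_mass hs ua) -(map_mass hL hu).
rewrite (eq_map (g := mass lam L)) => [|k]; last by rewrite hk mass_ord.
by apply: perm_map; apply: uniq_perm => // k; rewrite hE.
Qed.

Lemma content_block_const n (lam nu : odd_partition n) (s : seq S) :
  (n <= m)%N -> content lam s -> block_const nu s ->
  (size lam < size nu)%N \/ nu = lam.
Proof.
move=> hnm /forallP hc hb.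
have /andP[/and3P[lsort lp /eqP lsum] _] := op_seqP lam.
have /andP[/and3P[nsort np _] _] := op_seqP nu.
have hm : (size lam <= m)%N.
  by apply: leq_trans hnm; have := size_le_sumn lp; rewrite lsum.
have [ks hs hk] := block_const_mass np hb.
have [h1 h2] := mass_partition hm lp hs (fun k => etrans (esym (hk k)) (eqP (hc k))).
move: h1; rewrite leq_eqVlt => /orP[/eqP e|]; last by left.
right; apply: val_inj; apply: (sorted_eq _ _ nsort lsort (h2 e)).
  by move=> x y z h h'; apply: leq_trans h' h.
by move=> x y /anti_leq.
Qed.

Lemma exists_content_block_const n (lam : odd_partition n) : (n <= m)%N ->
  exists x : n.-tuple S, content lam x && block_const lam x.
Proof.
move=> hnm; have /andP[/and3P[lsort lp /eqP lsum] _] := op_seqP lam.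
have hm : (size lam <= m)%N.
  by apply: leq_trans hnm; have := size_le_sumn lp; rewrite lsum.
pose ks := [seq widen_ord hm i | i <- enum 'I_(size lam)].
have hsz : size lam = size ks by rewrite size_map size_enum_ord.
have hw : size (const_word lam ks) == n by rewrite size_const_word // lsum.
exists (Tuple hw); apply/andP; split; last exact: block_const_word.
by apply/forallP => k; rewrite const_word_mass // mass_ord.
Qed.

End Combinatorics.

(** * Linear independence modulo commutators *)
Section Independence.
Variables (R : realType) (n : nat).
Local Notation OP := (odd_partition n).
Local Notation C := R[i].
Local Notation S := (bool * 'I_n)%type.

Definition trace_entry (P : comNzRingType) (q : P) (lam nu : seq nat) : P :=
  \sum_(x : n.-tuple S) (content lam x)%:R *
    act_word q (block_word 0 nu) (fun t => (t == x :> seq S)%:R) x.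

Definition trace_mx (P : comNzRingType) (q : P) : 'M[P]_#|{: OP}| :=
  \matrix_(i, j) trace_entry q (enum_val j : OP) (enum_val i : OP).

Lemma trace_mx_morph (P P' : comNzRingType) (phi : {rmorphism P -> P'}) q :
  map_mx phi (trace_mx q) = trace_mx (phi q).
Proof.
apply/matrixP => i j; rewrite !mxE rmorph_sum; apply: eq_bigr => x _.
rewrite rmorphM rmorph_nat act_word_morph; congr (_ * _).
by apply: eq_act_word => t _ /=; rewrite rmorph_nat.
Qed.

Lemma trace_entry1 (lam nu : OP) :
  trace_entry (1 : C) lam nu
  = (\sum_(x : n.-tuple S) (content lam x && block_const nu x))%:R.
Proof.
rewrite natr_sum; apply: eq_bigr => x _.
have /andP[/and3P[_ _ /eqP hsum] hodd] := op_seqP nu.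
rewrite [act_word _ _ _ _]act_word_block_diag ?size_tuple //.
by rewrite -natrM mulnb.
Qed.

(** For a relation w among the rows, take a partition with w nonzero of the
    largest number of parts: in the column it indexes, only the diagonal entry
    contributes. *)
Lemma det_trace_mx1 : \det (trace_mx (1 : C)) != 0.
Proof.
apply/negP => /det0P[w w0 hw].
have [i0 hi0] : exists i, w 0 i != 0.
  apply/existsP; apply: contraR w0; rewrite negb_exists => /forallP h.
  by apply/eqP/rowP => i; rewrite mxE; apply/eqP; have := h i; rewrite negbK.
pose len (i : 'I_#|{: OP}|) := size (enum_val i : OP).
have [i hi imax] := @arg_maxnP _ i0 (fun i => w 0 i != 0) len hi0.
have := congr1 (fun M : 'rV_ _ => M 0 i) hw.
rewrite !mxE (bigD1 i) //= big1 => [|j hj]; last first.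
  rewrite mxE trace_entry1; have [->|hwj] := eqVneq (w 0 j) 0; first by rewrite mul0r.
  rewrite big1 ?mulr0 // => x _; apply/eqP; rewrite eqb0; apply/negP => /andP[h1 h2].
  case: (content_block_const (leqnn n) h1 h2) => [h|/enum_val_inj e].
    by have := imax j hwj; rewrite /= /len leqNgt h.
  by rewrite e eqxx in hj.
rewrite addr0 mxE trace_entry1 => /eqP; rewrite mulf_eq0 (negbTE hi) /=.
rewrite Num.Theory.pnatr_eq0 => /eqP h.
have [x hx] := exists_content_block_const (enum_val i : OP) (leqnn n).
by move: h; rewrite (bigD1 x) //= hx.
Qed.

(** The matrix is the image of one over the polynomials in the square root of v,
    whose value at 1 is the previous matrix. *)
Lemma det_trace_mx : \det (trace_mx (vK R)) != 0.
Proof.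
have -> : trace_mx (vK R) = map_mx (@tofrac {poly C}) (trace_mx ('X ^+ 2 : {poly C})).
  by rewrite trace_mx_morph.
rewrite det_map_mx tofrac_eq0; apply: contra det_trace_mx1 => /eqP h.
have <- : horner_eval (1 : C) ('X ^+ 2) = 1.
  by rewrite /horner_eval hornerXn expr1n.
by rewrite -trace_mx_morph det_map_mx h rmorph0.
Qed.

Lemma T_comp_independent (f : {ffun OP -> Aring (vK R)}) :
  in_commutators (\sum_nu f nu *: T_comp (vK R) n nu) -> f = 0.
Proof.
move=> hf; pose w := \row_(i < #|{: OP}|) A_val (f (enum_val i)).
suff w0 : w = 0.
  apply/ffunP => nu; rewrite ffunE; apply: val_inj.
  have := congr1 (fun M : 'rV_ _ => M 0 (enum_rank nu)) w0.
  by rewrite !mxE enum_rankK.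
apply/eqP; apply: contraNT det_trace_mx => hw; apply/det0P; exists w => //.
apply/rowP => j; rewrite !mxE.
rewrite -[RHS](chi_commutators n (enum_val j : OP) hf) chi_sum.
rewrite (reindex (fun i : 'I_#|{: OP}| => enum_val i)) /=; last first.
  by apply: onW_bij; apply: enum_val_bij.
apply: eq_bigr => i _; rewrite chiZ !mxE; congr (_ * _).
have /andP[/and3P[_ hp /eqP hsum] _] := op_seqP (enum_val i : OP).
rewrite T_compE ?hsum // chi_word //.
have := block_word_bounds 0 hp; rewrite add0n hsum.
by apply: sub_all => k.
Qed.

End Independence.

(** * The grading, and the theorem *)
Section Homogeneous.
Variables (K : comNzRingType) (X : choiceType) (odd_letter : pred X).
Local Notation F := (free_alg K X).
Local Notation homog := (@free_homog K X odd_letter).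

Lemma free_homog0 d : homog d 0.
Proof. by move=> w; rewrite mcoeff0 eqxx. Qed.

Lemma free_homog1 : homog false 1.
Proof.
move=> w; rewrite mcoeff1; case: (w =P _) => [->|]; last by rewrite eqxx.
by rewrite fm1.
Qed.

Lemma free_homog_letter x : homog (odd_letter x) (letter K x).
Proof.
move=> w; rewrite mcoeffU; case: (_ =P w) => [<- _|]; last by rewrite eqxx.
by rewrite fmU /= addn0 oddb.
Qed.

Lemma free_homogD d (x y : F) : homog d x -> homog d y -> homog d (x + y).
Proof.
move=> hx hy w; rewrite mcoeffD; have [->|h _] := eqVneq (mcoeff w x) 0.
  by rewrite add0r; apply: hy.
exact: hx.
Qed.

Lemma free_homogZ d (a : K) (x : F) : homog d x -> homog d (a *: x).
Proof.
move=> hx w; rewrite mcoeffZ; have [->|h _] := eqVneq (mcoeff w x) 0.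
  by rewrite mulr0 eqxx.
exact: hx.
Qed.

Lemma free_homogM d e (x y : F) : homog d x -> homog e y -> homog (d (+) e) (x * y).
Proof.
move=> hx hy w; rewrite mcoeff_neq0 => /msuppM_le[w1 [w2 [h1 h2 ->]]].
rewrite fmM count_cat oddD (hx w1) ?mcoeff_neq0 //.
by rewrite (hy w2) ?mcoeff_neq0.
Qed.

Variable rel : F -> Prop.
Local Notation phomog := (@presented_homog K X rel odd_letter).

Lemma presented_homog0 d : phomog d 0.
Proof. by exists 0; [apply: free_homog0|rewrite raddf0]. Qed.

Lemma presented_homog1 : phomog false 1.
Proof. by exists 1; [apply: free_homog1|rewrite presented_pi1]. Qed.

Lemma presented_homog_letter x :
  phomog (odd_letter x) (presented_pi rel (letter K x)).
Proof. by exists (letter K x); first apply: free_homog_letter. Qed.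

Lemma presented_homogD d x y : phomog d x -> phomog d y -> phomog d (x + y).
Proof.
move=> [x' hx ->] [y' hy ->]; exists (x' + y'); first exact: free_homogD.
exact/esym/raddfD.
Qed.

Lemma presented_homogZ d a x : phomog d x -> phomog d (a *: x).
Proof.
move=> [x' hx ->]; exists (a *: x'); first exact: free_homogZ.
exact/esym/presented_piZ.
Qed.

Lemma presented_homogM d e x y : phomog d x -> phomog e y -> phomog (d (+) e) (x * y).
Proof.
move=> [x' hx ->] [y' hy ->]; exists (x' * y'); first exact: free_homogM.
exact/esym/presented_piM.
Qed.

End Homogeneous.

Section Grading.
Variables (K : fieldType) (v : K) (n : nat).
Local Notation H := (HA v n).
Local Notation sub := (supported (HA_T v n) (HA_c v n) 0 n).

Lemma sub_homog d (x : H) : sub d x -> HA_homog d x.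
Proof.
elim=> {d x} [d||i h1 h2|j h1 h2|d x y _ hx _ hy|d r x _ hx|d e x y _ hx _ hy].
- exact: presented_homog0.
- exact: presented_homog1.
- case: HA_TP => [i' _|_]; last exact: presented_homog1.
  exact: (presented_homog_letter (@odd_gen n) (@hc_rel K v n) (inl i')).
- case: HA_cP => [j' _|]; last by move=> ?; lia.
  exact: (presented_homog_letter (@odd_gen n) (@hc_rel K v n) (inr j')).
- exact: presented_homogD.
- exact: presented_homogZ.
exact: presented_homogM.
Qed.

Lemma sub_gen_T i : sub false (gen_T v i).
Proof. by rewrite -HA_T_ord; apply: supportedT => //; rewrite -ltn_predRL. Qed.

Lemma sub_gen_c j : sub true (gen_c v j).
Proof. by rewrite -HA_c_ord; apply: supportedC. Qed.

Lemma HA_even_odd (h : H) : exists h0 h1, [/\ sub false h0, sub true h1 & h = h0 + h1].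
Proof.
suff {h} gen x : in_HA x -> exists h0 h1 : H,
    [/\ sub false h0, sub true h1 & x = HA_val (h0 + h1)].
  have [h0 [h1 [s0 s1 e]]] := gen _ (asboolW (HA_valP h)).
  by exists h0, h1; split=> //; apply: val_inj.
elim=> {x} [i|j||x y _ [a0 [a1 [sa0 sa1 ->]]] _ [b0 [b1 [sb0 sb1 ->]]]
  |x y _ [a0 [a1 [sa0 sa1 ->]]] _ [b0 [b1 [sb0 sb1 ->]]]|r x _ [a0 [a1 [sa0 sa1 ->]]]].
- exists (gen_T v i), 0; split; [exact: sub_gen_T|exact: supported0|by rewrite addr0].
- exists 0, (gen_c v j); split; [exact: supported0|exact: sub_gen_c|by rewrite add0r].
- exists 1, 0; split; [exact: supported1|exact: supported0|by rewrite addr0].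
- exists (a0 - b0), (a1 - b1); split; try by apply: supportedD => //; apply: supportedN.
  have -> : a0 - b0 + (a1 - b1) = (a0 + a1) - (b0 + b1) by rewrite opprD addrACA.
  by [].
- exists (a0 * b0 + a1 * b1), (a0 * b1 + a1 * b0); split.
  + by apply: supportedD; [apply: (supportedM sa0 sb0)|apply: (supportedM sa1 sb1)].
  + by apply: supportedD; [apply: (supportedM sa0 sb1)|apply: (supportedM sa1 sb0)].
  have -> : a0 * b0 + a1 * b1 + (a0 * b1 + a1 * b0) = (a0 + a1) * (b0 + b1).
    by rewrite mulrDl !mulrDr [a1 * b0 + _]addrC addrACA.
  by [].
exists (r *: a0), (r *: a1); split; try exact: supportedZ.
by rewrite -scalerDr.
Qed.

Lemma sub_T_perm s : sub false (T_perm v s).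
Proof.
rewrite /T_perm; elim: (reduced_word s) => [|i w IH].
  by rewrite big_nil; apply: supported1.
by rewrite big_cons; apply: (supportedM (sub_gen_T i) IH).
Qed.

Lemma sub_C_set (I : {set 'I_n}) : sub (odd #|I|) (C_set v I).
Proof.
rewrite /C_set -sum1_card; elim: (index_enum _) => [|j w IH].
  by rewrite !big_nil; apply: supported1.
rewrite !big_cons; case: (j \in I) => //.
by rewrite oddD; apply: (supportedM (sub_gen_c j) IH).
Qed.

Lemma sub_T_comp (nu : odd_partition n) : sub false (T_comp v n nu).
Proof.
have /andP[/and3P[_ hp /eqP hsum] _] := op_seqP nu.
rewrite T_compE ?hsum //; apply: supported_T_word.
by have := block_word_bounds 0 hp; rewrite add0n hsum.
Qed.

Lemma in_commutatorsD (x y : H) : in_commutators x -> in_commutators y ->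
  in_commutators (x + y).
Proof. by move=> [s ->] [t ->]; exists (s ++ t); rewrite big_cat. Qed.

Lemma in_commutatorsZ (r : Aring v) (x : H) : in_commutators x ->
  in_commutators (r *: x).
Proof.
move=> [s ->]; exists [seq (r * p.1, p.2) | p <- s]; rewrite big_map scaler_sumr.
by apply: eq_bigr => p _; rewrite scalerA.
Qed.

Hypotheses (v_neq0 : v != 0) (two_neq0 : 2%:R != 0 :> K) (n_gt0 : (0 < n)%N).

Lemma even_span (x : H) : sub false x ->
  exists f : {ffun odd_partition n -> Aring v},
    in_commutators (x - \sum_nu f nu *: T_comp v n nu).
Proof.
pose G (x : H) := exists f : {ffun odd_partition n -> Aring v},
    in_commutators (x - \sum_nu f nu *: T_comp v n nu).
rewrite -/(G x) => hx.
have halfP : exists h : Aring v, h + h = 1.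
  exists (halfA v); apply: val_inj.
  by rewrite /= -mulr2n -[X in X = _]mulr_natl mulfV.
have vP : exists u : Aring v, u * vA v = 1.
  by exists (viA v); apply: val_inj; rewrite /= mulVf.
apply: (tracial_even (@HA_T_quad K v n) (@HA_T_comm K v n) (@HA_T_braid K v n)
  (@HA_c_sq K v n) (@HA_c_anti K v n) (@HA_Tc_far K v n) (@HA_Tc K v n)
  _ vP halfP (G := G) _ _ _ _ n_gt0 hx).
- by move=> i hi; case: HA_TP => // j e; have := ltn_ord j; lia.
- move=> y z [f hf] [g hg]; exists (f + g).
  have := in_commutatorsD hf hg; congr in_commutators.
  rewrite addrACA -opprD -big_split; congr (_ - _); apply: eq_bigr => nu _.
  by rewrite ffunE scalerDl.
- move=> r y [f hf]; exists [ffun nu => r * f nu].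
  have := in_commutatorsZ r hf; congr in_commutators.
  rewrite scalerBr scaler_sumr; congr (_ - _); apply: eq_bigr => nu _.
  by rewrite ffunE scalerA.
- move=> y z; exists 0; exists [:: (1, (y, z))]; rewrite big_seq1 scale1r.
  by rewrite big1 ?subr0 // => nu _; rewrite ffunE scale0r.
move=> s hs ho; have hso : is_partition n s && all odd s by rewrite hs.
pose nu := OddPartition hso; exists [ffun mu => (mu == nu)%:R].
exists [::]; rewrite big_nil (bigD1 nu) //= big1 => [|mu /negbTE hmu]; last first.
  by rewrite ffunE hmu scale0r.
have /and3P[_ hp /eqP hsum] := hs.
by rewrite ffunE eqxx scale1r addr0 T_compE ?hsum // subrr.
Qed.

End Grading.

Theorem corollary4p9 (R : realType) (n : nat) (n_ge1 : (1 <= n)%N) :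
  (forall phi psi : {scalar HA (vK R) n},
      trace_function phi -> trace_function psi ->
      (forall nu : odd_partition n,
          phi (T_comp (vK R) n nu) = psi (T_comp (vK R) n nu)) ->
      forall h : HA (vK R) n, phi h = psi h)
  /\
  (forall (s : 'S_n) (I : {set 'I_n}), ~~ odd #|I| ->
      exists! f : {ffun odd_partition n -> Aring (vK R)},
        cong_even_commutators (T_perm (vK R) s * C_set (vK R) I)
          (\sum_(nu : odd_partition n) f nu *: T_comp (vK R) n nu)).
Proof.
have v0 : vK R != 0.
  by rewrite tofrac_eq0 expf_eq0 polyX_eq0.
have two0 : 2%:R != 0 :> C_sqrt_v R.
  rewrite -(rmorph_nat (@tofrac {poly R[i]})) tofrac_eq0.
  by rewrite -polyC_natr polyC_eq0 Num.Theory.pnatr_eq0.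
split=> [phi psi [phiC phi1] [psiC psi1] e h|s I hI].
  have [h0 [h1 [s0 s1 ->]]] := HA_even_odd h.
  rewrite !linearD /= (phi1 h1) ?(psi1 h1) ?addr0; try exact: sub_homog.
  have [f [c hc]] := even_span v0 two0 n_ge1 s0.
  have val (chi : {scalar HA (vK R) n}) : (forall x y, chi (x * y) = chi (y * x)) ->
      chi h0 = \sum_nu f nu * chi (T_comp (vK R) n nu).
    move=> chiC; rewrite -[h0](subrK (\sum_nu f nu *: T_comp (vK R) n nu)) hc.
    rewrite linearD /= linear_sum big1_seq /= => [|p _]; last first.
      by rewrite linearZ /= linearB /= chiC subrr mulr0.
    by rewrite add0r linear_sum; apply: eq_bigr => nu _; rewrite linearZ.
  by rewrite (val phi phiC) (val psi psiC); apply: eq_bigr => nu _; rewrite e.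
have sx : supported (HA_T (vK R) n) (HA_c (vK R) n) 0 n false
            (T_perm (vK R) s * C_set (vK R) I).
  by rewrite -(negbTE hI) -[odd _]addFb; apply: (supportedM (sub_T_perm _ s) (sub_C_set _ I)).
have [f hf] := even_span v0 two0 n_ge1 sx.
exists f; split=> [|g [hg _]].
  split=> //; apply: sub_homog; apply: supportedD => //; apply: supportedN.
  elim/big_ind: _ => [|x y|nu _]; [exact: supported0|exact: supportedD|].
  exact/supportedZ/sub_T_comp.
apply/eqP; rewrite eq_sym -subr_eq0; apply/eqP/T_comp_independent.
have := in_commutatorsD hf (in_commutatorsZ (-1) hg); congr in_commutators.
rewrite scaleN1r opprB addrC addrA subrK.
rewrite -sumrB; apply: eq_bigr => nu _.
by rewrite !ffunE scalerBl.
Qed.
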